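(* Let $h\in\mathbb{R}$. In the setting and notation fixed in the context, assume that for some $v>0$ $$H(\phi^{-1}(\bar B_c^{R-v}\times\bar B_u^r\times\bar B_s^r))<h<H(\phi^{-1}(\partial\bar B_c^{R}\times\bar B_u^r\times\bar B_s^r)).$$ Assume also that for every $p\in\bar B_c^R\times\{0\}\times\{0\}$ the constants computed on $N_p$ satisfy $$\kappa_c^{\text{forw}},\kappa_s^{\text{forw}}<\kappa_u^{\text{forw}},\qquad 0<\kappa_u^{\text{forw}},$$ $$\kappa_s^{\text{back}}<0,\qquad \kappa_s^{\text{back}}<\kappa_c^{\text{back}},\kappa_u^{\text{back}},$$ and that there exist $E_u,E_s>0$ such that for every $q\in N_p\cap(\bar B_c^R\times\{0\}\times\{0\})$ $$\|\pi_xF^\phi(q)\|<rE_u,\qquad \|\pi_yF^\phi(q)\|<rE_s,$$ and $$E_u+\varepsilon_u<\delta^u,\qquad E_s+\varepsilon_s<\delta^s.$$ Then there exists a $C^0$ function $\chi:\bar B_c^{R-v}\to D_\phi$ such that: 1. For any $\theta\in\bar B_c^{R-v}$ we have $\pi_\theta\chi(\theta)=\theta$ and $\Phi(t,\phi^{-1}(\chi(\theta)))\in D$ for all $t\in\mathbb{R}$. 2. If for some $\mathbf{x}\in\phi^{-1}(\bar B_c^{R-v}\times\bar B_u^r\times\bar B_s^r)$ we have $\Phi(t,\mathbf{x})\in D$ for all $t\in\mathbb{R}$, then there exists $\theta\in\bar B_c^{R-v}$ such that $\mathbf{x}=\phi^{-1}(\chi(\theta))$.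
   Context: ODE. $F:\mathbb{R}^n\to\mathbb{R}^n$ is a vector field for which $\mathbf{x}'=F(\mathbf{x})$ satisfies the usual assumptions for existence and uniqueness of solutions; $\Phi(t,\mathbf{x})$ is the induced flow. The ODE has a fixed point $\mathbf{x}_0$ and an integral of motion $H:\mathbb{R}^n\to\mathbb{R}$, i.e. $H$ is constant along every solution. Aligned coordinates. $n=c+u+s$; $\bar B_i^\varrho$ ($i\in\{c,u,s\}$) is the closed ball of radius $\varrho$ centred at $0$ in $\mathbb{R}^i$. $U\subset\mathbb{R}^n$ is open, $D\subset U$ is compact, $\mathbf{x}_0\in D$, and $\phi:U\to\phi(U)\subset\mathbb{R}^n$ is a diffeomorphism with $\phi(D)=D_\phi:=\bar B_c^R\times\bar B_u^r\times\bar B_s^r$, for some $R,r>0$. Points are written $p=(\theta,x,y)$ with $\theta\in\mathbb{R}^c$, $x\in\mathbb{R}^u$, $y\in\mathbb{R}^s$, and $\pi_\theta,\pi_x,\pi_y$ are the projections. $\partial A$ is the boundary of $A$. For a set $A$, $H(\phi^{-1}(A))<h$ means that the inequality holds at every point of the set (similarly for $>$). Norms are Euclidean norms and the induced operator norms. Vector field in aligned coordinates: $F^\phi(p)=D\phi(\phi^{-1}(p))F(\phi^{-1}(p))$, assumed $C^1$. For $N\subset D_\phi$, its derivative enclosure is $$[dF^\phi(N)]=\Big\{A\in\mathbb{R}^{n\times n}: A_{ij}\in\Big[\inf_{p\in N}\tfrac{\partial F_i^\phi}{\partial p_j}(p),\sup_{p\in N}\tfrac{\partial F_i^\phi}{\partial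 p_j}(p)\Big]\ \forall i,j\Big\}.$$ Constants. $\gamma,\alpha_h,\alpha_v,\beta_h,\beta_v>0$ are fixed with $\alpha_h>\alpha_v$ and $\beta_v>\beta_h$, and $\rho>0$ satisfies $\rho>r\sqrt{\alpha_h/\gamma}$, $\rho>r\sqrt{\beta_v/\gamma}$. For $p=(\theta,0,0)\in\bar B_c^R\times\{0\}\times\{0\}$ let $$N_p:=\big(\bar B_c(\theta,\rho)\times\bar B_u^r\times\bar B_s^r\big)\cap D_\phi,$$ where $\bar B_c(\theta,\rho)$ is the closed ball in $\mathbb{R}^c$ of radius $\rho$ centred at $\theta$. For each such $p$ suppose, in block form with respect to $(\theta,x,y)$, $$[dF^\phi(N_p)]\subset\begin{pmatrix}\mathbf{C}&\boldsymbol{\varepsilon}_c&\boldsymbol{\varepsilon}_c\\ \boldsymbol{\varepsilon}_m&\mathbf{A}&\boldsymbol{\varepsilon}_u\\ \boldsymbol{\varepsilon}_m&\boldsymbol{\varepsilon}_s&\mathbf{B}\end{pmatrix},$$ where the entries are interval matrices (matrices with interval coefficients); the two blocks called $\boldsymbol{\varepsilon}_c$ need not be equal, likewise the two blocks $\boldsymbol{\varepsilon}_m$. Let $\delta^u,\delta^s,\varepsilon_c,\varepsilon_m,\varepsilon_u,\varepsilon_s>0$ and $c^u,c^s\in\mathbb{R}$ (all may depend on $p$) be such that for all matrices $A\in\mathbf{A}$, $B\in\mathbf{B}$, $C\in\mathbf{C}$ and all $e_i\in\boldsymbol{\varepsilon}_i$ (for either block with that name), $i\in\{m,c,u,s\}$: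 $$\inf_{\|x\|=1}x^TAx>\delta^u,\quad \sup_{\|y\|=1}y^TBy<-\delta^s,\quad c^s<\inf_{\|\theta\|=1}\theta^TC\theta\le\sup_{\|\theta\|=1}\theta^TC\theta<c^u,\quad \|e_i\|<\varepsilon_i.$$ Define (for each $p$) $$\kappa_c^{\text{forw}}=c^u+\tfrac12\big(\tfrac{\alpha_h}{\gamma}\varepsilon_m+\tfrac{\beta_h}{\gamma}\varepsilon_m+2\varepsilon_c\big),$$ $$\kappa_u^{\text{forw}}=\delta^u-\tfrac12\big(\varepsilon_m+\varepsilon_u+\tfrac{\gamma}{\alpha_h}\varepsilon_c+\tfrac{\beta_h}{\alpha_h}\varepsilon_s\big),$$ $$\kappa_s^{\text{forw}}=-\delta^s+\tfrac12\big(\varepsilon_m+\tfrac{\alpha_h}{\beta_h}\varepsilon_u+\tfrac{\gamma}{\beta_h}\varepsilon_c+\varepsilon_s\big),$$ $$\kappa_c^{\text{back}}=c^s-\tfrac12\big(\tfrac{\alpha_v}{\gamma}\varepsilon_m+\tfrac{\beta_v}{\gamma}\varepsilon_m+2\varepsilon_c\big),$$ $$\kappa_u^{\text{back}}=\delta^u-\tfrac12\big(\varepsilon_m+\varepsilon_u+\tfrac{\gamma}{\alpha_v}\varepsilon_c+\tfrac{\beta_v}{\alpha_v}\varepsilon_s\big),$$ $$\kappa_s^{\text{back}}=-\delta^s+\tfrac12\big(\varepsilon_m+\tfrac{\alpha_v}{\beta_v}\varepsilon_u+\tfrac{\gamma}{\beta_v}\varepsilon_c+\varepsilon_s\big).$$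 *)

(* Defs.v *)
From HB Require Import structures.
From mathcomp Require Import all_boot all_order all_algebra.
From mathcomp Require Import all_classical all_reals all_analysis.

Set Implicit Arguments.
Unset Strict Implicit.
Unset Printing Implicit Defensive.

Import Order.TTheory GRing.Theory Num.Theory.
Import numFieldNormedType.Exports.

Local Open Scope classical_set_scope.
Local Open Scope ring_scope.

(* The library norm on 'M[R]_(m, n) is the max norm, hence the explicit
   Euclidean norm; both induce the topology carried by 'cV[R]_n. *)
Definition enorm (R : realType) (n : nat) (x : 'cV[R]_n) : R :=
  Num.sqrt (\sum_i x i 0 ^+ 2).

Definition eopnorm (R : realType) (m n : nat) (A : 'M[R]_(m, n)) : R :=
  sup [set enorm (A *m x) | x in [set x : 'cV[R]_n | enorm x <= 1]].

(* Empty when [r < 0]. *)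
Definition cball (R : realType) (n : nat) (a : 'cV[R]_n) (r : R) :
  set 'cV[R]_n := [set x | enorm (x - a) <= r].

Definition boundary (T : topologicalType) (A : set T) : set T :=
  closure A `\` A°.

(* Entry (i, j) is the partial derivative of the i-th component with respect
   to the j-th variable. *)
Definition jac (R : realType) (m n : nat) (f : 'cV[R]_n -> 'cV[R]_m)
    (p : 'cV[R]_n) : 'M[R]_(m, n) :=
  \matrix_(i < m, j < n) 'D_(delta_mx j 0) (fun q => f q i 0) p.

Definition C1_on (R : realType) (m n : nat) (A : set 'cV[R]_n)
    (f : 'cV[R]_n -> 'cV[R]_m) : Prop :=
  forall x, A x -> differentiable f x /\ {for x, continuous (jac f)}.

(* [phi] is a C^1 diffeomorphism from [U] onto [phi @` U], with inverse [psi].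
   Both are total functions; their values outside [U], resp. [phi @` U], are
   irrelevant. *)
Definition diffeo_on (R : realType) (n : nat) (U : set 'cV[R]_n)
    (phi psi : 'cV[R]_n -> 'cV[R]_n) : Prop :=
  [/\ open U, open (phi @` U), (forall x, U x -> psi (phi x) = x),
      C1_on U phi & C1_on (phi @` U) psi].

Definition is_solution (R : realType) (n : nat) (F : 'cV[R]_n -> 'cV[R]_n)
    (J : set R) (g : R -> 'cV[R]_n) : Prop :=
  forall t : R, J t -> is_derive t (1 : R) g (F (g t)).

(* Existence and uniqueness of solutions of x' = F(x): every [x] has a unique
   maximal solution [Phi^~ x], defined on the open interval [dom x]; [Phi t x]
   is irrelevant for [t] outside [dom x]. *)
Definition is_flow (R : realType) (n : nat) (F : 'cV[R]_n -> 'cV[R]_n)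
    (dom : 'cV[R]_n -> set R) (Phi : R -> 'cV[R]_n -> 'cV[R]_n) : Prop :=
  forall x,
    [/\ open (dom x), is_interval (dom x), dom x 0, Phi 0 x = x
      & is_solution F (dom x) (Phi^~ x)] /\
    forall (J : set R) (g : R -> 'cV[R]_n),
      open J -> is_interval J -> J 0 -> g 0 = x -> is_solution F J g ->
      J `<=` dom x /\ (forall t, J t -> g t = Phi t x).

Definition integral_of_motion (R : realType) (n : nat)
    (dom : 'cV[R]_n -> set R) (Phi : R -> 'cV[R]_n -> 'cV[R]_n)
    (H : 'cV[R]_n -> R) : Prop :=
  forall x t, dom x t -> H (Phi t x) = H x.

(* The solution through [x] exists for all times and stays in [D]. *)
Definition stays_in (R : realType) (n : nat)
    (dom : 'cV[R]_n -> set R) (Phi : R -> 'cV[R]_n -> 'cV[R]_n)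
    (D : set 'cV[R]_n) (x : 'cV[R]_n) : Prop :=
  forall t, dom x t /\ D (Phi t x).

(* F^phi(p) = Dphi(phi^-1(p)) F(phi^-1(p)) *)
Definition aligned_field (R : realType) (n : nat)
    (phi psi F : 'cV[R]_n -> 'cV[R]_n) (p : 'cV[R]_n) : 'cV[R]_n :=
  'd phi (psi p) (F (psi p)).

Section AlignedCoordinates.
Variables (R : realType) (c u s : nat).

Definition pi_th (p : 'cV[R]_(c + (u + s))) : 'cV[R]_c := usubmx p.
Definition pi_x (p : 'cV[R]_(c + (u + s))) : 'cV[R]_u := usubmx (dsubmx p).
Definition pi_y (p : 'cV[R]_(c + (u + s))) : 'cV[R]_s := dsubmx (dsubmx p).

Definition prod3 (A : set 'cV[R]_c) (B : set 'cV[R]_u) (C : set 'cV[R]_s) :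
    set 'cV[R]_(c + (u + s)) :=
  [set p | [/\ A (pi_th p), B (pi_x p) & C (pi_y p)]].

Definition Dphi (Rc r : R) : set 'cV[R]_(c + (u + s)) :=
  prod3 (cball 0 Rc) (cball 0 r) (cball 0 r).

(* N_p for p = (th, 0, 0). *)
Definition Nbox (Rc r rho : R) (th : 'cV[R]_c) : set 'cV[R]_(c + (u + s)) :=
  prod3 (cball th rho) (cball 0 r) (cball 0 r) `&` Dphi Rc r.

End AlignedCoordinates.

Definition enclosure (R : realType) (n : nat) (f : 'cV[R]_n -> 'cV[R]_n)
    (N : set 'cV[R]_n) : set 'M[R]_n :=
  [set A | forall i j,
     (ereal_inf [set (jac f p i j)%:E | p in N] <= (A i j)%:E)%E /\
     ((A i j)%:E <= ereal_sup [set (jac f p i j)%:E | p in N])%E].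

Definition in_imx (R : realType) (m n : nat) (M : 'M[interval R]_(m, n)) :
  set 'M[R]_(m, n) := [set A | forall i j, A i j \in M i j].

Definition qform (R : realType) (n : nat) (A : 'M[R]_n) (x : 'cV[R]_n) : R :=
  (x^T *m A *m x) 0 0.

(* Extended reals: the unit sphere of R^0 is empty, so that there the infimum
   is +oo and the supremum is -oo. *)
Definition qform_inf (R : realType) (n : nat) (A : 'M[R]_n) : \bar R :=
  ereal_inf [set (qform A x)%:E | x in [set x | enorm x = 1]].

Definition qform_sup (R : realType) (n : nat) (A : 'M[R]_n) : \bar R :=
  ereal_sup [set (qform A x)%:E | x in [set x | enorm x = 1]].

(* The interval blocks
      ( mC   mec1 mec2 )
      ( mem1 mA   meu  )
      ( mem2 mes  mB   )
   and the constants attached to one point p. *)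
Record block_data (R : realType) (c u s : nat) := BlockData {
  mC : 'M[interval R]_(c, c);
  mA : 'M[interval R]_(u, u);
  mB : 'M[interval R]_(s, s);
  mec1 : 'M[interval R]_(c, u);
  mec2 : 'M[interval R]_(c, s);
  mem1 : 'M[interval R]_(u, c);
  mem2 : 'M[interval R]_(s, c);
  meu : 'M[interval R]_(u, s);
  mes : 'M[interval R]_(s, u);
  delta_u : R;
  delta_s : R;
  c_u : R;
  c_s : R;
  eps_c : R;
  eps_m : R;
  eps_u : R;
  eps_s : R }.

Section BlockData.
Variables (R : realType) (c u s : nat) (b : block_data R c u s).

Definition block_imx : 'M[interval R]_(c + (u + s)) :=
  block_mx (mC b) (row_mx (mec1 b) (mec2 b))
           (col_mx (mem1 b) (mem2 b)) (block_mx (mA b) (meu b) (mes b) (mB b)).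

Definition imx_norm_lt (m n : nat) (M : 'M[interval R]_(m, n)) (e : R) : Prop :=
  forall E, in_imx M E -> eopnorm E < e.

Record block_bounds : Prop := BlockBounds {
  delta_u_gt0 : 0 < delta_u b;
  delta_s_gt0 : 0 < delta_s b;
  eps_c_gt0 : 0 < eps_c b;
  eps_m_gt0 : 0 < eps_m b;
  eps_u_gt0 : 0 < eps_u b;
  eps_s_gt0 : 0 < eps_s b;
  bound_A : forall A, in_imx (mA b) A -> ((delta_u b)%:E < qform_inf A)%E;
  bound_B : forall B, in_imx (mB b) B -> (qform_sup B < (- delta_s b)%:E)%E;
  bound_C : forall C, in_imx (mC b) C ->
    ((c_s b)%:E < qform_inf C)%E /\ (qform_sup C < (c_u b)%:E)%E;
  bound_ec1 : imx_norm_lt (mec1 b) (eps_c b);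
  bound_ec2 : imx_norm_lt (mec2 b) (eps_c b);
  bound_em1 : imx_norm_lt (mem1 b) (eps_m b);
  bound_em2 : imx_norm_lt (mem2 b) (eps_m b);
  bound_eu : imx_norm_lt (meu b) (eps_u b);
  bound_es : imx_norm_lt (mes b) (eps_s b) }.

(* Forward constants are to be taken at (alpha, beta) = (alpha_h, beta_h),
   backward ones at (alpha_v, beta_v). *)
Variables (gamma alpha beta : R).

Definition kappa_c_forw : R :=
  c_u b + 2^-1 * (alpha / gamma * eps_m b + beta / gamma * eps_m b
                  + 2 * eps_c b).

Definition kappa_u_forw : R :=
  delta_u b - 2^-1 * (eps_m b + eps_u b + gamma / alpha * eps_c b
                      + beta / alpha * eps_s b).

Definition kappa_s_forw : R :=
  - delta_s b + 2^-1 * (eps_m b + alpha / beta * eps_u b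
                        + gamma / beta * eps_c b + eps_s b).

Definition kappa_c_back : R :=
  c_s b - 2^-1 * (alpha / gamma * eps_m b + beta / gamma * eps_m b
                  + 2 * eps_c b).

Definition kappa_u_back : R :=
  delta_u b - 2^-1 * (eps_m b + eps_u b + gamma / alpha * eps_c b
                      + beta / alpha * eps_s b).

Definition kappa_s_back : R :=
  - delta_s b + 2^-1 * (eps_m b + alpha / beta * eps_u b
                        + gamma / beta * eps_c b + eps_s b).

End BlockData.

(* Main.v *)
Require Import Defs.
From HB Require Import structures.
From mathcomp Require Import all_boot all_order all_algebra.
From mathcomp Require Import all_classical all_reals all_analysis.
From mathcomp Require Import ring lra.
Import Order.TTheory GRing.Theory Num.Theory.
Import numFieldNormedType.Exports.
Local Open Scope classical_set_scope.
Local Open Scope ring_scope.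

Set Implicit Arguments.
Unset Strict Implicit.
Unset Printing Implicit Defensive.

(** In aligned coordinates the field points out of the box through [|x| = r]
    and into it through [|y| = r] (face_out, face_in), and an orbit that starts
    over the inner ball never meets the side [|th| = Rc], where [H] has values
    that the orbit cannot take. So such an orbit leaves the box in forward time
    only through [x] and in backward time only through [y].

    The rate conditions make the quadratic form
    [alpha_h |x|^2 - gamma |th|^2 - beta_h |y|^2] of the difference of two orbits
    increase wherever it is nonnegative (forward_cone). Two distinct orbits that
    stay in the box for all positive times therefore never differ by a vector of
    this cone (cone_separation): the points that stay in forward time have an
    [x] component that is a Lipschitz function of [(th, y)]. Reversing time
    exchanges [x] and [y] (backward_cone), and the points that stay in backward
    time have a [y] component that is a Lipschitz function of [(th, x)]. Over a
    fixed [th] the two graphs have slopes whose product is less than one, because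
    [alpha_v < alpha_h] and [beta_h < beta_v]; they meet (graphs_meet), in a
    single point that depends on [th] in a Lipschitz way (graphs_lip). This
    point is [chi th], and every orbit that stays in [D] arises so.

    There remains the existence, for given [th] and [y], of a point that stays in
    forward time (trapped_orbit). Instead of a topological degree, the cone
    condition is used once more. A disc over the whole [x] ball whose chords lie
    in the cone is stretched by a short Euler step over the whole [x] ball again:
    since the step is close to the identity, a point of the disc over a prescribed
    [x] is the fixed point of a contraction (step_cover). Iterating this yields
    Euler orbits that stay in the box for as many steps as desired. In these steps
    the [th] and [y] components are retracted to their balls, which shortens
    only the components that count negatively in the cone form. As the step
    tends to zero the initial points cluster at some [x], and the true orbit from
    [(th, x, y)] is followed by Euler orbits as long as it stays in the box. It
    cannot reach [|x| = r], since the Euler orbits would then be expelled shortly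
    afterwards (no_exit); hence it stays in the box for ever. That its maximal
    interval of existence is unbounded is confined_continuation.

    Both arguments need rates bounded away from zero, although the constants are
    attached to each centre separately; uniform_margin obtains such a bound by
    compactness, and the strict inequality between [rho] and the width of the cone
    leaves room to change centres (uniform_cone). *)

(** * Euclidean norm, balls and contractions *)

Section Euclid.
Variables (R : realType) (n : nat).
Implicit Types (x y z : 'cV[R]_n) (a e r : R).

Definition dot x y : R := \sum_i x i 0 * y i 0.

Lemma dotC x y : dot x y = dot y x.
Proof. by apply: eq_bigr => i _; rewrite mulrC. Qed.

Lemma dotDl x y z : dot (x + y) z = dot x z + dot y z.
Proof. by rewrite -big_split; apply: eq_bigr => i _; rewrite mxE mulrDl. Qed.

Lemma dotZl a x y : dot (a *: x) y = a * dot x y.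
Proof. by rewrite mulr_sumr; apply: eq_bigr => i _; rewrite mxE mulrA. Qed.

Lemma dotNl x y : dot (- x) y = - dot x y.
Proof. by rewrite -scaleN1r dotZl mulN1r. Qed.

Lemma dotBl x y z : dot (x - y) z = dot x z - dot y z.
Proof. by rewrite dotDl dotNl. Qed.

Lemma dotDr x y z : dot x (y + z) = dot x y + dot x z.
Proof. by rewrite dotC dotDl !(dotC _ x). Qed.

Lemma dotZr a x y : dot x (a *: y) = a * dot x y.
Proof. by rewrite dotC dotZl dotC. Qed.

Lemma dotNr x y : dot x (- y) = - dot x y.
Proof. by rewrite dotC dotNl dotC. Qed.

Lemma dotBr x y z : dot x (y - z) = dot x y - dot x z.
Proof. by rewrite dotDr dotNr. Qed.

Definition dotE := (dotDl, dotDr, dotBl, dotBr, dotNl, dotNr, dotZl, dotZr).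

Lemma dot0l x : dot 0 x = 0.
Proof. by rewrite -(scale0r x) dotZl mul0r. Qed.

Lemma dot_ge0 x : 0 <= dot x x.
Proof. by apply: sumr_ge0 => i _; rewrite -expr2 sqr_ge0. Qed.

Lemma enorm_sq x : enorm x ^+ 2 = dot x x.
Proof.
rewrite sqr_sqrtr; first by apply: eq_bigr => i _; rewrite expr2.
by apply: sumr_ge0 => i _; rewrite sqr_ge0.
Qed.

Lemma enorm_ge0 x : 0 <= enorm x.
Proof. exact: sqrtr_ge0. Qed.

Lemma enorm_le x a : 0 <= a -> (enorm x <= a) = (dot x x <= a ^+ 2).
Proof. by move=> a0; rewrite -enorm_sq ler_sqr ?nnegrE ?enorm_ge0. Qed.

Lemma enorm_coord x i : `|x i 0| <= enorm x.
Proof.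
rewrite -(ler_sqr (normr_ge0 _) (enorm_ge0 _)) ?nnegrE ?enorm_ge0//.
rewrite enorm_sq /dot (bigD1 i)//= real_normK ?num_real// expr2 lerDl.
by apply: sumr_ge0 => j _; rewrite -expr2 sqr_ge0.
Qed.

Lemma enorm0 : enorm (0 : 'cV[R]_n) = 0.
Proof. by apply/eqP; rewrite eq_le enorm_ge0 enorm_le// dot0l expr0n lexx. Qed.

Lemma enorm_eq0 x : enorm x = 0 -> x = 0.
Proof.
move=> x0; apply/colP => i; rewrite mxE; apply/eqP.
by rewrite -normr_le0 -x0 enorm_coord.
Qed.

Lemma enormZ a x : enorm (a *: x) = `|a| * enorm x.
Proof.
apply/eqP; rewrite -(eqrXn2 (n := 2)) ?mulr_ge0 ?enorm_ge0//.
by rewrite exprMn !enorm_sq !dotE real_normK ?num_real// expr2 mulrA.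
Qed.

Lemma enormN x : enorm (- x) = enorm x.
Proof. by rewrite -scaleN1r enormZ normrN1 mul1r. Qed.

Lemma enormB x y : enorm (x - y) = enorm (y - x).
Proof. by rewrite -opprB enormN. Qed.

Lemma dot_enorm x y : dot x y <= enorm x * enorm y.
Proof.
have [y0|y0] := eqVneq (enorm y) 0.
  by rewrite y0 (enorm_eq0 y0) dotC dot0l mulr0.
have [x0|x0] := eqVneq (enorm x) 0.
  by rewrite x0 (enorm_eq0 x0) dot0l mul0r.
have := dot_ge0 (enorm y *: x - enorm x *: y).
rewrite !dotE (dotC y x) -!enorm_sq => h.
have xy : 0 < enorm x * enorm y by rewrite mulr_gt0 // lt0r ?x0 ?y0 enorm_ge0.
rewrite -subr_ge0 -(pmulr_rge0 _ xy).
by rewrite -(pmulr_rge0 _ (ltr0Sn R 1)); apply: le_trans h _; lra.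
Qed.

Lemma dot_enormN x y : - (enorm x * enorm y) <= dot x y.
Proof. by rewrite lerNl -dotNl -(enormN x) dot_enorm. Qed.

Lemma enormD x y : enorm (x + y) <= enorm x + enorm y.
Proof.
rewrite enorm_le ?addr_ge0 ?enorm_ge0// !dotE (dotC y x) -!enorm_sq.
by have := dot_enorm x y; lra.
Qed.

Lemma enormDB z x y : enorm (x - y) <= enorm (x - z) + enorm (z - y).
Proof. by have := enormD (x - z) (z - y); rewrite subrKA. Qed.

Lemma enorm_le_norm x : enorm x <= n.+1%:R * `|x|.
Proof.
rewrite enorm_le ?mulr_ge0//.
have h i : x i 0 * x i 0 <= `|x| ^+ 2.
  rewrite -expr2 -real_normK ?num_real// lerXn2r ?nnegrE//.
  by rewrite [leRHS]/Num.Def.normr/= mx_normrE; apply: (le_bigmax _ _ (i, 0)).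
rewrite (le_trans (ler_sum _ (fun i _ => h i)))// sumr_const card_ord.
rewrite -[leLHS]mulr_natl exprMn; apply: ler_wpM2r; first exact: sqr_ge0.
rewrite -natrX ler_nat (leq_trans (leqnSn n))//.
by rewrite -{1}(muln1 n.+1) expnS leq_pmul2l ?expn1.
Qed.

Lemma norm_le_enorm x : `|x| <= enorm x.
Proof.
rewrite /Num.Def.normr/= mx_normrE; apply: bigmax_le; first exact: enorm_ge0.
by move=> [i j] _ /=; rewrite (ord1 j) enorm_coord.
Qed.

(** The topology of ['cV_n] is given by the max norm; through this equivalence
    every limit is taken in the Euclidean norm, which measures the cones. *)
Lemma nbhs_enormP x (A : set 'cV[R]_n) :
  nbhs x A <-> exists2 e, 0 < e & forall y, enorm (y - x) < e -> A y.
Proof.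
split=> [/nbhs_ballP[e /= e0 eA]|[e e0 eA]].
  exists e => // y yx; apply: eA; rewrite -ball_normE /ball_ /=.
  by rewrite distrC (le_lt_trans (norm_le_enorm _)).
apply/nbhs_ballP; exists (e / n.+1%:R); rewrite /= ?divr_gt0// => y /=.
rewrite -ball_normE /ball_/= distrC ltr_pdivlMr// mulrC => yx; apply: eA.
by rewrite (le_lt_trans (enorm_le_norm _)).
Qed.

(** Compactness of a ball as it serves for limits of initial conditions, of
    points along an orbit and of centres: a sequence returns close to some
    point of the ball infinitely often. *)
Lemma enorm_cluster (r : R) (w : nat -> 'cV[R]_n) :
  (forall k, enorm (w k) <= r) ->
  exists2 l, enorm l <= r &
    forall e N, 0 < e -> exists2 k, (N <= k)%N & enorm (w k - l) < e.
Proof.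
move=> wr.
have := @rV_compact R n (fun=> `[- r, r]%classic) (fun=> @segment_compact R _ _).
move=> /(_ ((fun k => (w k)^T) @ \oo)) [|].
  exists 0%N => // k _ i /=; rewrite mxE in_itv/= -ler_norml.
  exact: le_trans (enorm_coord _ _) (wr k).
move=> l [_ lcl].
have cl e N : 0 < e -> exists2 k, (N <= k)%N & enorm (w k - l^T) < e.
  move=> e0; have e1 : 0 < e / n.+1%:R by rewrite divr_gt0.
  have := lcl [set x | exists2 k, (N <= k)%N & x = (w k)^T] (ball l (e / n.+1%:R)).
  case => [||x [[k Nk ->]]].
  - by exists N => // k /= Nk; exists k.
  - exact: nbhsx_ballx.
  rewrite -ball_normE /ball_/= distrC => kl; exists k => //.
  apply: le_lt_trans (enorm_le_norm _) _.
  rewrite mulrC -ltr_pdivlMr// (le_lt_trans _ kl)//.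
  rewrite [leLHS]/Num.Def.normr/= mx_normrE; apply: bigmax_le => // -[i j] _ /=.
  have -> : (w k - l^T) i j = ((w k)^T - l) j i by rewrite !mxE.
  rewrite [leRHS]/Num.Def.normr/= mx_normrE.
  exact: (le_bigmax _ (fun p : 'I_1 * 'I_n => `|((w k)^T - l) p.1 p.2|) (j, i)).
exists l^T => //; apply/ler_addgt0Pr => e e0.
have [k _ kl] := cl e 0%N e0.
rewrite -(subrK (w k) l^T) addrC (le_trans (enormD _ _))// lerD// -enormB.
exact: ltW.
Qed.

Definition clamp r x : 'cV[R]_n :=
  if enorm x <= r then x else (r / enorm x) *: x.

Lemma clamp_id r x : enorm x <= r -> clamp r x = x.
Proof. by rewrite /clamp => ->. Qed.

Lemma clamp_le r x : 0 <= r -> enorm (clamp r x) <= r.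
Proof.
rewrite /clamp => r0; case: ifPn => //; rewrite -ltNge => rx.
rewrite enormZ ger0_norm ?divr_ge0 ?enorm_ge0// divfK// gt_eqF//.
exact: le_lt_trans r0 rx.
Qed.

(** The clamped point is the nearest point of the ball: the ball lies on one
    side of the hyperplane through it orthogonal to the displacement. *)
Lemma clamp_proj r x z : 0 <= r -> enorm z <= r ->
  dot (x - clamp r x) (z - clamp r x) <= 0.
Proof.
rewrite /clamp => r0 zr; case: ifPn => [_|]; first by rewrite subrr dot0l.
rewrite -ltNge => rx; have x0 : 0 < enorm x := le_lt_trans r0 rx.
set l := r / enorm x.
have l1 : l <= 1 by rewrite ler_pdivrMr// mul1r ltW.
have -> : x - l *: x = (1 - l) *: x by rewrite scalerBl scale1r.
rewrite dotZl mulr_ge0_le0 ?subr_ge0// dotBr dotZr -enorm_sq subr_le0.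
rewrite expr2 mulrA divfK ?gt_eqF//.
by rewrite (le_trans (dot_enorm _ _))// mulrC ler_wpM2r ?enorm_ge0.
Qed.

Lemma clamp_nexp r x y : 0 <= r -> enorm (clamp r x - clamp r y) <= enorm (x - y).
Proof.
move=> r0.
have h1 := clamp_proj x r0 (clamp_le y r0).
have h2 := clamp_proj y r0 (clamp_le x r0).
have [->|d0] := eqVneq (enorm (clamp r x - clamp r y)) 0; first exact: enorm_ge0.
rewrite -(ler_pM2r (_ : 0 < enorm (clamp r x - clamp r y))); last first.
  by rewrite lt0r d0 enorm_ge0.
apply: le_trans (dot_enorm _ _); rewrite -expr2 enorm_sq.
by move: h1 h2; rewrite !dotE !(dotC (clamp r y)) !(dotC y); lra.
Qed.

Lemma clamp_dist r x z : enorm z <= r -> enorm (clamp r x - z) <= enorm (x - z).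
Proof.
by move=> zr; rewrite -{1}(clamp_id zr) clamp_nexp// (le_trans (enorm_ge0 _) zr).
Qed.

(** Along the iterates the displacement decays geometrically; a cluster point of
    the iterates is therefore fixed. *)
Lemma contraction_fixpoint r (G : 'cV[R]_n -> 'cV[R]_n) a : 0 <= r ->
  0 <= a < 1 -> (forall x, enorm x <= r -> enorm (G x) <= r) ->
  (forall x y, enorm x <= r -> enorm y <= r ->
     enorm (G x - G y) <= a * enorm (x - y)) ->
  exists2 x, enorm x <= r & G x = x.
Proof.
move=> r0 /andP[a0 a1] Gr Ga.
pose w k := iter k G 0.
have wr k : enorm (w k) <= r by elim: k => [|k /Gr//]; rewrite /w /= enorm0.
have wa k : enorm (G (w k) - w k) <= a ^+ k * (enorm (G 0)).
  elim: k => [|k IH]; first by rewrite expr0 mul1r /w /= subr0.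
  have -> : w k.+1 = G (w k) by [].
  by rewrite (le_trans (Ga _ _ (Gr _ (wr k)) (wr k)))// exprS -mulrA ler_wpM2l.
have [l lr cl] := enorm_cluster wr.
exists l => //; apply/eqP; rewrite -subr_eq0; apply/eqP/enorm_eq0/eqP.
rewrite eq_le enorm_ge0 andbT; apply/ler_addgt0Pr => e e0; rewrite add0r.
have e3 : 0 < e / 3 by rewrite divr_gt0.
have [N _ HN] : \forall k \near \oo, `|0 - a ^+ k * enorm (G 0)| < e / 3.
  have /cvgrPdist_lt : (fun k => a ^+ k * enorm (G 0)) @ \oo --> (0 : R).
    rewrite -(mul0r (enorm (G 0))); apply: cvgM; last exact: cvg_cst.
    by apply: cvg_expr; rewrite ger0_norm.
  exact.
have [k Nk kl] := cl _ N e3.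
have := HN k Nk; rewrite sub0r normrN => /(le_lt_trans (ler_norm _)) hk.
have h1 := enormDB (w k) (G l) l; have h2 := enormDB (G (w k)) (G l) (w k).
have h3 := Ga _ _ lr (wr k); have h4 := wa k.
have h5 : a * enorm (l - w k) <= enorm (w k - l).
  by rewrite enormB ler_piMl ?enorm_ge0 ?ltW.
by lra.
Qed.

End Euclid.

(** * Calculus along curves *)

Section Calculus.
Variable R : realType.

(** Least-upper-bound form of a continuity argument: a property that starts,
    passes to left limits and always extends to the right holds forever. *)
Lemma real_induction (P : R -> Prop) : P 0 ->
  (forall t, 0 < t -> (forall s, 0 <= s < t -> P s) -> P t) ->
  (forall t, 0 <= t -> (forall s, 0 <= s <= t -> P s) ->
     exists2 e, 0 < e & forall s, t < s < t + e -> P s) ->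
  forall t, 0 <= t -> P t.
Proof.
move=> P0 Plim Pext t t0; apply: contrapT => nPt.
pose S := [set x | 0 <= x /\ forall y, 0 <= y <= x -> P y].
have S0 : S 0 by split=> // y; rewrite -eq_le => /eqP <-.
have St x : S x -> x <= t.
  move=> [x0 Sx]; rewrite leNgt; apply/negP => tx.
  by apply: nPt; apply: Sx; rewrite t0 ltW.
have hS : has_sup S by split; [exists 0|exists t => x /St].
have m0 : 0 <= sup S by apply: ub_le_sup => //; exact: hS.2.
have Plt y : 0 <= y < sup S -> P y.
  move=> /andP[y0 ym].
  have [|x [x0 Sx] yx] := sup_adherent (eps := sup S - y) _ hS.
    by rewrite subr_gt0.
  by apply: Sx; rewrite y0 /=; move: yx; lra.
have Pm : P (sup S).
  move: m0; rewrite le_eqVlt => /predU1P[<-//|m0]; exact: Plim.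
have Ple y : 0 <= y <= sup S -> P y.
  move=> /andP[y0]; rewrite le_eqVlt => /predU1P[->//|ym]; apply: Plt.
  by rewrite y0.
have [e e0 Pe] := Pext _ m0 Ple.
have : S (sup S + e / 2).
  split=> [|y /andP[y0 ye]]; first by move: m0; lra.
  have [ym|my] := leP y (sup S); first by apply: Ple; rewrite y0.
  by apply: Pe; rewrite my /=; lra.
by move=> /(ub_le_sup hS.2); lra.
Qed.

(** First-order expansion with an explicit remainder: two one-sided estimates
    in this form glue into a derivative. *)
Lemma is_derive_epsP (V : normedModType R) (f : R -> V) (t : R) (v : V) :
  is_derive t (1 : R) f v <-> forall e, 0 < e ->
    exists2 d, 0 < d &
      forall s, `|s - t| < d -> `|f s - f t - (s - t) *: v| <= e * `|s - t|.
Proof.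
pose g h := h^-1 *: ((f \o shift t) (h *: 1) - f t).
have E (e d : R) : 0 < e ->
    (forall s, `|s - t| < d -> `|f s - f t - (s - t) *: v| <= e * `|s - t|) <->
    (forall h, `|h| < d -> h != 0 -> `|v - g h| <= e).
  move=> e0; split=> [fd h hd h0|fd s sd].
    have := fd (h + t); rewrite addrK => /(_ hd) H.
    have -> : v - g h = - (h^-1 *: (f (h + t) - f t - h *: v)).
      rewrite scalerBr scalerA mulVf// scale1r opprB /g /=.
      by rewrite [h *: 1]mulr1.
    rewrite normrN normrZ normfV mulrC ler_pdivrMr ?normr_gt0//.
  have [->|st] := eqVneq s t.
    by rewrite !subrr scale0r subr0 !normr0 mulr0.
  have st0 : s - t != 0 by rewrite subr_eq0.
  have := fd (s - t) sd st0.
  have -> : v - g (s - t) = - ((s - t)^-1 *: (f s - f t - (s - t) *: v)).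
    rewrite scalerBr scalerA mulVf// scale1r opprB /g /=.
    by rewrite [(s - t) *: 1]mulr1 subrK.
  by rewrite normrN normrZ normfV mulrC ler_pdivrMr ?normr_gt0.
have C : is_derive t (1 : R) f v <-> g @ 0^' --> v.
  split=> [[dfv <-]|gv]; first exact: dfv.
  split; first by apply/cvg_ex; exists v.
  exact: cvg_lim gv.
rewrite C; split=> [/cvgrPdist_le gv e e0|H].
  have [d /= d0 dg] := gv e e0.
  exists d => //; apply/(E e d e0) => h hd h0; apply: dg => //=.
  by rewrite sub0r normrN.
apply/cvgrPdist_le => e e0; have [d d0 /(E e d e0) dg] := H e e0.
by exists d => //= h /=; rewrite sub0r normrN; exact: dg.
Qed.

Lemma is_derive_right_gt (f : R -> R) (t v a : R) : is_derive t (1 : R) f v -> a < v ->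
  exists2 d, 0 < d & forall s, t < s < t + d -> f t + a * (s - t) < f s.
Proof.
move=> /is_derive_epsP H av; have [|d d0 fd] := H ((v - a) / 2); first by lra.
exists d => // s /andP[ts sd].
have st0 : 0 < s - t by lra.
have := fd s; rewrite gtr0_norm// => /(_ ltac:(lra)).
rewrite ler_norml => /andP[+ _]; rewrite [_ *: _]mulrC; nra.
Qed.

Section Curves.
Variable n : nat.
Implicit Types (q : R -> 'cV[R]_n) (t : R) (v : 'cV[R]_n).

(** The equivalence of norms costs a factor, absorbed by the arbitrary [e]. *)
Lemma is_derive_enormP q t v :
  is_derive t (1 : R) q v <-> forall e, 0 < e ->
    exists2 d, 0 < d &
      forall s, `|s - t| < d ->
        enorm (q s - q t - (s - t) *: v) <= e * `|s - t|.
Proof.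
rewrite is_derive_epsP; split=> H e e0.
  have [|d d0 dq] := H (e / n.+1%:R); first by rewrite divr_gt0.
  exists d => // s sd; rewrite (le_trans (enorm_le_norm _))//.
  by rewrite mulrC -ler_pdivlMr// mulrAC dq.
have [d d0 dq] := H e e0; exists d => // s sd.
exact: le_trans (norm_le_enorm _) (dq s sd).
Qed.

Lemma is_derive_near q t v e : is_derive t (1 : R) q v -> 0 < e ->
  exists2 d, 0 < d & forall s, `|s - t| < d -> enorm (q s - q t) < e.
Proof.
move=> /is_derive_enormP/(_ 1 ltr01)[d d0 dq] e0.
have v1 : 0 < 1 + enorm v by rewrite ltr_wpDr ?enorm_ge0.
exists (Num.min d (e / (1 + enorm v))); first by rewrite lt_min d0 divr_gt0.
move=> s; rewrite lt_min => /andP[/dq h]; rewrite ltr_pdivlMr// => h2.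
have := enormD (q s - q t - (s - t) *: v) ((s - t) *: v).
rewrite subrK enormZ; lra.
Qed.

Lemma is_derive_coordP q t v :
  is_derive t (1 : R) q v <-> forall i, is_derive t 1 (fun s => q s i 0) (v i 0).
Proof.
split=> [dq i|dq].
  have [d _] := dq; split; first exact: (derivable_mxP _ _ _).1.
  by rewrite -[in RHS](@derive_val _ _ _ _ _ _ _ dq) derive_mx// mxE.
have D : derivable q t 1.
  by apply/derivable_mxP => i j; rewrite (ord1 j); case: (dq i).
split=> //; rewrite derive_mx//; apply/colP => i; rewrite mxE.
by case: (dq i).
Qed.

Lemma is_derive_dot (p q : R -> 'cV[R]_n) t v w :
  is_derive t (1 : R) p v -> is_derive t 1 q w ->
  is_derive t (1 : R) (fun s => dot (p s) (q s)) (dot v (q t) + dot (p t) w).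
Proof.
move=> /is_derive_coordP dp /is_derive_coordP dq.
have -> : (fun s => dot (p s) (q s)) =
    \sum_i ((fun s => p s i 0) * (fun s => q s i 0)).
  by apply/funext => s; rewrite fct_sumE.
apply: is_derive_eq; rewrite -big_split /=; apply: eq_bigr => i _.
by rewrite addrC [_ *: w i 0]mulrC [_ *: v i 0]mulrC (mulrC (w i 0)).
Qed.

(** Mean value inequality: the scalar mean value theorem applied to the
    component of [q] in the direction of the error itself. *)
Lemma mean_value_ineq q (dq : R -> 'cV[R]_n) a b w B : a <= b ->
  (forall t, a <= t <= b -> is_derive t (1 : R) q (dq t)) ->
  (forall t, a <= t <= b -> enorm (dq t - w) <= B) ->
  enorm (q b - q a - (b - a) *: w) <= B * (b - a).
Proof.
move=> ab dqP dqB; set z := q b - q a - _.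
pose g (t : R) := dot (q t) z - t * dot w z.
have dg t : a <= t <= b -> is_derive t (1 : R) g (dot (dq t) z - dot w z).
  move=> /dqP dqt; apply: is_deriveB.
    have := is_derive_dot dqt (is_derive_cst z t 1).
    by rewrite (dotC _ 0) dot0l addr0.
  rewrite (_ : (fun _ => _) = (dot w z) \*: (@id R)); last first.
    by apply/funext => s /=; rewrite [RHS]mulrC.
  by apply: is_derive_eq; rewrite [LHS]mulr1.
have [||x xab gx] := @MVT_segment R g (fun t => dot (dq t) z - dot w z) a b ab.
- by move=> x; rewrite in_itv/= => /andP[? ?]; apply: dg; rewrite !ltW.
- apply: derivable_within_continuous => x; rewrite in_itv/= => /dg.
  by case.
have h : enorm z ^+ 2 = dot (dq x - w) z * (b - a).
  rewrite dotBl -gx enorm_sq {1}/z /g !dotE -/z; lra.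
have := dot_enorm (dq x - w) z; have := dqB x; rewrite in_itv/= in xab.
move=> /(_ xab) h1 h2; have z0 := enorm_ge0 z.
have [->|zn] := eqVneq (enorm z) 0.
  by rewrite mulr_ge0 ?subr_ge0// (le_trans (enorm_ge0 _) h1).
have zp : 0 < enorm z by rewrite lt0r zn.
rewrite -(ler_pM2l zp) -expr2 h.
have h3 : dot (dq x - w) z <= B * enorm z.
  by rewrite (le_trans h2)// ler_wpM2r.
have ba : 0 <= b - a by rewrite subr_ge0.
by rewrite mulrA ler_wpM2r// mulrC.
Qed.

End Curves.

Lemma is_derive_rowsub m n (f : 'I_m -> 'I_n) (q : R -> 'cV[R]_n) (t : R) v :
  is_derive t (1 : R) q v ->
  is_derive t (1 : R) (fun s => rowsub f (q s)) (rowsub f v).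
Proof.
move=> /is_derive_coordP dq; apply/is_derive_coordP => i; rewrite mxE.
by rewrite (_ : (fun s => _) = fun s => q s (f i) 0)//; apply/funext=> s; rewrite mxE.
Qed.

End Calculus.

(** * Splittings of the coordinates and the cone form *)

(** The function increases wherever it is nonnegative, so it cannot cross zero
    downwards. *)
Lemma is_derive_ge0 (R : realType) (Z dZ : R -> R) :
  (forall t : R, 0 <= t -> is_derive t (1 : R) Z (dZ t)) -> 0 <= Z 0 ->
  (forall t : R, 0 <= t -> 0 <= Z t -> 0 < dZ t) -> forall t : R, 0 <= t -> 0 <= Z t.
Proof.
move=> ZP Z0 dZ0; apply: real_induction => // [t t0 H|t t0 H].
  rewrite leNgt; apply/negP => Zt.
  have /is_derive_epsP/(_ 1 ltr01)[d d0 h] := ZP t (ltW t0).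
  pose k := 1 + (1 + `|dZ t|).
  have k0 : 0 < k by rewrite /k; have := normr_ge0 (dZ t); lra.
  pose e := Num.min (Num.min (d / 2) t) (- Z t / k).
  have e0 : 0 < e by rewrite !lt_min t0 !divr_gt0// oppr_gt0.
  have ed : e <= d / 2 by rewrite !ge_min lexx.
  have et : e <= t by rewrite !ge_min lexx orbT.
  have ek : e * k <= - Z t by rewrite -ler_pdivlMr// ge_min lexx orbT.
  have := h (t - e); rewrite (_ : t - e - t = - e); last by lra.
  rewrite normrN gtr0_norm// => /(_ ltac:(lra)) /ler_normlW.
  have := H (t - e) ltac:(lra); rewrite [_ *: _]mulrC => h1 h2.
  have := ler_norm (- dZ t); rewrite normrN => h3.
  by rewrite /k in ek; nra.
have [d d0 h] := is_derive_right_gt (ZP t t0) (dZ0 t t0 (H t ltac:(lra))).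
exists d => // s sd; have := h s sd; have := H t ltac:(lra); lra.
Qed.

(** A splitting of R^n into three blocks of coordinates. Both time directions
    use the same blocks with the last two exchanged, so that what is proved for
    forward orbits of an abstract splitting holds for backward ones. *)
Record frame (R : realType) (n c u s : nat) := Frame {
  idx_t : 'I_c -> 'I_n;
  idx_x : 'I_u -> 'I_n;
  idx_y : 'I_s -> 'I_n;
  join : 'cV[R]_c -> 'cV[R]_u -> 'cV[R]_s -> 'cV[R]_n;
  join_t : forall th x y, rowsub idx_t (join th x y) = th;
  join_x : forall th x y, rowsub idx_x (join th x y) = x;
  join_y : forall th x y, rowsub idx_y (join th x y) = y;
  frame_dot : forall a b : 'cV[R]_n,
    dot a b = dot (rowsub idx_t a) (rowsub idx_t b)
      + dot (rowsub idx_x a) (rowsub idx_x b)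
      + dot (rowsub idx_y a) (rowsub idx_y b) }.

Section Frame.
Variables (R : realType) (n c u s : nat) (F : frame R n c u s).
Variables (a g b : R) (Rc r : R).
Implicit Types p q d e : 'cV[R]_n.

Definition ct p : 'cV[R]_c := rowsub (idx_t F) p.
Definition cx p : 'cV[R]_u := rowsub (idx_x F) p.
Definition cy p : 'cV[R]_s := rowsub (idx_y F) p.

Lemma ctB p q : ct (p - q) = ct p - ct q. Proof. exact: linearB. Qed.
Lemma cxB p q : cx (p - q) = cx p - cx q. Proof. exact: linearB. Qed.
Lemma cyB p q : cy (p - q) = cy p - cy q. Proof. exact: linearB. Qed.
Lemma ctD p q : ct (p + q) = ct p + ct q. Proof. exact: linearD. Qed.
Lemma cxD p q : cx (p + q) = cx p + cx q. Proof. exact: linearD. Qed.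
Lemma cyD p q : cy (p + q) = cy p + cy q. Proof. exact: linearD. Qed.
Lemma ctZ l p : ct (l *: p) = l *: ct p. Proof. exact: linearZ. Qed.
Lemma cxZ l p : cx (l *: p) = l *: cx p. Proof. exact: linearZ. Qed.
Lemma cyZ l p : cy (l *: p) = l *: cy p. Proof. exact: linearZ. Qed.
Definition compE := (ctB, cxB, cyB, ctD, cxD, cyD, ctZ, cxZ, cyZ).

Lemma ct_join th x y : ct (join F th x y) = th. Proof. exact: join_t. Qed.
Lemma cx_join th x y : cx (join F th x y) = x. Proof. exact: join_x. Qed.
Lemma cy_join th x y : cy (join F th x y) = y. Proof. exact: join_y. Qed.
Definition joinE := (ct_join, cx_join, cy_join).

Lemma dot_comp p q :
  dot p q = dot (ct p) (ct q) + dot (cx p) (cx q) + dot (cy p) (cy q).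
Proof. exact: frame_dot. Qed.

Lemma enorm_comp p :
  enorm p ^+ 2 = enorm (ct p) ^+ 2 + enorm (cx p) ^+ 2 + enorm (cy p) ^+ 2.
Proof. by rewrite !enorm_sq dot_comp. Qed.

Lemma ct_le p : enorm (ct p) <= enorm p.
Proof.
rewrite -ler_sqr ?nnegrE ?enorm_ge0// enorm_comp.
by have := sqr_ge0 (enorm (cx p)); have := sqr_ge0 (enorm (cy p)); lra.
Qed.

Lemma cx_le p : enorm (cx p) <= enorm p.
Proof.
rewrite -ler_sqr ?nnegrE ?enorm_ge0// enorm_comp.
by have := sqr_ge0 (enorm (ct p)); have := sqr_ge0 (enorm (cy p)); lra.
Qed.

Lemma cy_le p : enorm (cy p) <= enorm p.
Proof.
rewrite -ler_sqr ?nnegrE ?enorm_ge0// enorm_comp.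
by have := sqr_ge0 (enorm (ct p)); have := sqr_ge0 (enorm (cx p)); lra.
Qed.

Definition box : set 'cV[R]_n :=
  [set p | [/\ enorm (ct p) <= Rc, enorm (cx p) <= r & enorm (cy p) <= r]].

(** Polar form of [a |x|^2 - g |th|^2 - b |y|^2]; the cone is the set where
    this quadratic form is nonnegative. *)
Definition cone_form d e : R :=
  a * dot (cx d) (cx e) - g * dot (ct d) (ct e) - b * dot (cy d) (cy e).

Lemma cone_formDZ d e t : cone_form (d + t *: e) (d + t *: e) =
  cone_form d d + t * (2 * cone_form d e + t * cone_form e e).
Proof.
rewrite /cone_form !compE !dotE (dotC (cx e) (cx d)) (dotC (ct e) (ct d)).
by rewrite (dotC (cy e) (cy d)); ring.
Qed.

Hypotheses (a0 : 0 < a) (g0 : 0 < g) (b0 : 0 < b).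

Lemma cone_enorm d : 0 <= cone_form d d ->
  enorm d <= (1 + a / g + a / b) * enorm (cx d).
Proof.
rewrite /cone_form => cd; set C := 1 + _ + _.
have ag : 0 < a / g by rewrite divr_gt0.
have ab : 0 < a / b by rewrite divr_gt0.
have C1 : 1 <= C by rewrite /C; lra.
rewrite enorm_le ?mulr_ge0 ?enorm_ge0//; last by lra.
rewrite exprMn enorm_sq dot_comp.
have ht : dot (ct d) (ct d) <= a / g * dot (cx d) (cx d).
  rewrite mulrAC ler_pdivlMr//.
  by have := mulr_ge0 (ltW b0) (dot_ge0 (cy d)); lra.
have hy : dot (cy d) (cy d) <= a / b * dot (cx d) (cx d).
  rewrite mulrAC ler_pdivlMr//.
  by have := mulr_ge0 (ltW g0) (dot_ge0 (ct d)); lra.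
have CC : C <= C ^+ 2 by rewrite expr2 ler_peMl//; lra.
have := dot_ge0 (cx d) => hx.
apply: (@le_trans _ _ (C * dot (cx d) (cx d))); last by rewrite ler_wpM2r.
by rewrite /C; lra.
Qed.

Lemma is_derive_cone (q : R -> 'cV[R]_n) (t : R) v : is_derive t (1 : R) q v ->
  is_derive t (1 : R) (fun s => cone_form (q s) (q s)) (2 * cone_form (q t) v).
Proof.
move=> dq.
have dx := is_derive_rowsub (idx_x F) dq.
have dt := is_derive_rowsub (idx_t F) dq.
have dy := is_derive_rowsub (idx_y F) dq.
have -> : (fun s => cone_form (q s) (q s)) =
   a \*: (fun s => dot (cx (q s)) (cx (q s))) -
   g \*: (fun s => dot (ct (q s)) (ct (q s))) -
   b \*: (fun s => dot (cy (q s)) (cy (q s))) by [].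
have ddx := is_derive_dot dx dx.
have ddt := is_derive_dot dt dt.
have ddy := is_derive_dot dy dy.
apply: is_derive_eq.
rewrite /cone_form /cx /ct /cy -!/(cx _) -!/(ct _) -!/(cy _).
rewrite (dotC (cx v)) (dotC (ct v)) (dotC (cy v)).
by rewrite /GRing.scale /=; ring.
Qed.

Variables (f : 'cV[R]_n -> 'cV[R]_n) (m : R).
Hypotheses (m0 : 0 < m).
Hypothesis f_cone : forall p q, box p -> box q -> 0 <= cone_form (p - q) (p - q) ->
  m * enorm (p - q) ^+ 2 <= cone_form (p - q) (f p - f q).

(** Along two confined orbits the quadratic form [W] of the difference [d]
    has derivative at least [2 m |d|^2 >= (2 m / a) W] while [W >= 0]. Once positive
    it grows at least linearly for ever, which confinement forbids; and it
    becomes positive at once when it starts at zero with [d <> 0]. *)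
Lemma cone_separation (q1 q2 : R -> 'cV[R]_n) :
  (forall t : R, 0 <= t -> box (q1 t) /\ is_derive t (1 : R) q1 (f (q1 t))) ->
  (forall t : R, 0 <= t -> box (q2 t) /\ is_derive t (1 : R) q2 (f (q2 t))) ->
  0 <= cone_form (q1 0 - q2 0) (q1 0 - q2 0) -> q1 0 = q2 0.
Proof.
move=> h1 h2; pose d t := q1 t - q2 t; rewrite -!/(d 0) => W0.
apply/eqP; rewrite -subr_eq0 -/(d 0); apply/eqP; apply: contrapT => /eqP d0.
have dn : 0 < enorm (d 0).
  rewrite lt0r enorm_ge0 andbT; apply: contra d0 => /eqP/enorm_eq0 ->.
  exact: eqxx.
pose W t := cone_form (d t) (d t).
pose W' t := 2 * cone_form (d t) (f (q1 t) - f (q2 t)).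
have WP (t : R) : 0 <= t -> is_derive t (1 : R) W (W' t).
  move=> t0; apply: is_derive_cone; apply: is_deriveB.
    by case: (h1 t t0).
  by case: (h2 t t0).
have W'_ge t : 0 <= t -> 0 <= W t -> 2 * (m * enorm (d t) ^+ 2) <= W' t.
  move=> t0 Wt; rewrite ler_pM2l//; apply: f_cone => //.
  - by case: (h1 t t0).
  - by case: (h2 t t0).
have W_le t : 0 <= t -> W t <= a * enorm (d t) ^+ 2.
  move=> t0; rewrite enorm_sq dot_comp /W /cone_form.
  have := mulr_ge0 (ltW g0) (dot_ge0 (ct (d t))).
  have := mulr_ge0 (ltW b0) (dot_ge0 (cy (d t))).
  have := mulr_ge0 (ltW a0) (dot_ge0 (ct (d t))).
  have := mulr_ge0 (ltW a0) (dot_ge0 (cy (d t))); lra.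
have W_bnd t : 0 <= t -> W t <= a * (2 * r) ^+ 2.
  move=> t0; apply: (@le_trans _ _ (a * enorm (cx (d t)) ^+ 2)).
    rewrite enorm_sq /W /cone_form.
    have := mulr_ge0 (ltW g0) (dot_ge0 (ct (d t))).
    have := mulr_ge0 (ltW b0) (dot_ge0 (cy (d t))); lra.
  rewrite ler_pM2l// lerXn2r ?nnegrE ?enorm_ge0//.
    by have [[_ + _] _] := h1 t t0; have := enorm_ge0 (cx (q1 t)); lra.
  rewrite /d cxB (le_trans (enormD _ _))// enormN.
  have [[_ + _] _] := h1 t t0; have [[_ + _] _] := h2 t t0; lra.
have [t1 t10 Wt1] : exists2 t1, 0 <= t1 & 0 < W t1.
  move: W0; rewrite -/(W 0) le_eqVlt => /predU1P[W0|]; last by exists 0.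
  have W'0 : 0 < W' 0.
    apply: lt_le_trans (W'_ge 0 (lexx _) _); last by rewrite -W0.
    by rewrite !mulr_gt0// exprn_gt0.
  have [e e0 he] := is_derive_right_gt (WP 0 (lexx _)) W'0.
  exists (e / 2); first by rewrite divr_ge0// ltW.
  by have := he (e / 2) ltac:(lra); lra.
pose k := m * W t1 / a.
have k0 : 0 < k by rewrite divr_gt0// mulr_gt0.
pose Z t := W (t + t1) - (W t1 + k * t).
have Zge t : 0 <= t -> 0 <= Z t.
  apply: (@is_derive_ge0 _ Z (fun t => W' (t + t1) - k)) => [{}t t0||{}t t0].
  - have t2 : 0 <= t + t1 by rewrite addr_ge0.
    apply/is_derive_epsP => e e0.
    have /is_derive_epsP/(_ e e0)[dd dd0 hd] := WP _ t2.
    exists dd => // x xd; have := hd (x + t1).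
    rewrite (_ : x + t1 - (t + t1) = x - t); last by ring.
    have -> : Z x - Z t - (x - t) *: (W' (t + t1) - k) =
        W (x + t1) - W (t + t1) - (x - t) *: W' (t + t1).
      rewrite /Z /GRing.scale /=.
      by move: (W (x + t1)) (W (t + t1)) (W t1) (W' (t + t1)) => *; ring.
    by apply.
  - by rewrite /Z add0r mulr0 addr0 subrr.
  - rewrite /Z => Zt; have t2 : 0 <= t + t1 by rewrite addr_ge0.
    have kt : 0 <= k * t by rewrite mulr_ge0// ltW.
    have Wt : W t1 <= W (t + t1) by lra.
    have : k < 2 * k by lra.
    move=> /lt_le_trans; rewrite subr_gt0; apply.
    apply: le_trans (W'_ge _ t2 _); last by apply: le_trans Wt; exact: ltW.
    rewrite ler_pM2l// /k -mulrA ler_pM2l// ler_pdivrMr// mulrC.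
    exact: le_trans Wt (W_le _ t2).
pose T := a * (2 * r) ^+ 2 / k.
have T0 : 0 <= T := divr_ge0 (mulr_ge0 (ltW a0) (sqr_ge0 _)) (ltW k0).
have := Zge T T0; have := W_bnd (T + t1) (addr_ge0 T0 t10).
rewrite /Z (mulrC k) divfK ?gt_eqF//; lra.
Qed.

End Frame.

(** * Horizontal discs and Euler orbits *)

Section Euler.
Variables (R : realType) (n c u s : nat) (F : frame R n c u s).
Variables (a g b : R) (Rc r : R) (f : 'cV[R]_n -> 'cV[R]_n) (m L : R).
Local Notation ct := (ct F).
Local Notation cx := (cx F).
Local Notation cy := (cy F).
Local Notation box := (box F Rc r).
Local Notation cone := (cone_form F a g b).
Hypotheses (a0 : 0 < a) (g0 : 0 < g) (b0 : 0 < b).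
Hypotheses (Rc0 : 0 <= Rc) (r0 : 0 < r) (m0 : 0 < m) (L0 : 0 < L).
Hypothesis f_cone : forall p q, box p -> box q -> 0 <= cone (p - q) (p - q) ->
  m * enorm (p - q) ^+ 2 <= cone (p - q) (f p - f q).
Hypothesis f_lip : forall p q, box p -> box q ->
  enorm (f p - f q) <= L * enorm (p - q).
Hypothesis f_out : forall p, box p -> enorm (cx p) = r ->
  0 < dot (cx p) (cx (f p)).

(** Euler step in which the [th] and [y] components are retracted to their
    balls, so that only the [x] component can leave the box. *)
Definition step (tau : R) p : 'cV[R]_n :=
  let p' := p + tau *: f p in
  join F (clamp Rc (ct p')) (cx p') (clamp r (cy p')).

(** Both retractions fix the components of [z] and are nonexpansive. *)
Lemma step_dist tau p z : box z ->
  enorm (step tau p - z) <= enorm (p + tau *: f p - z).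
Proof.
move=> [zt zx zy]; rewrite -ler_sqr ?nnegrE ?enorm_ge0//.
rewrite !(enorm_comp F) /step !(ctB, cxB, cyB) !joinE !lerD//.
  by rewrite ler_sqr ?nnegrE ?enorm_ge0// clamp_dist.
by rewrite ler_sqr ?nnegrE ?enorm_ge0// clamp_dist.
Qed.

(** Clamping only shortens the [th] and [y] components of a difference, which
    enter the cone form with a minus sign. *)
Lemma step_cone tau p q : 0 <= tau -> tau * ((g + b) * L ^+ 2) <= 2 * m ->
  box p -> box q -> 0 <= cone (p - q) (p - q) ->
  0 <= cone (step tau p - step tau q) (step tau p - step tau q).
Proof.
move=> t0 tm bp bq pq; have h := f_cone bp bq pq.
set d := p - q in pq h *; set e := f p - f q in h *.
have de : p + tau *: f p - (q + tau *: f q) = d + tau *: e.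
  by rewrite /d /e scalerBr opprD addrACA.
have h1 : 0 <= cone (d + tau *: e) (d + tau *: e).
  rewrite cone_formDZ.
  rewrite addr_ge0// mulr_ge0//.
  have ce : - ((g + b) * (L * enorm d) ^+ 2) <= cone e e.
    have := f_lip bp bq; rewrite -/d -/e => eL.
    have : enorm e ^+ 2 <= (L * enorm d) ^+ 2.
      by rewrite lerXn2r ?nnegrE ?enorm_ge0// mulr_ge0 ?enorm_ge0 ?ltW.
    rewrite enorm_sq (dot_comp F) => eL2.
    rewrite /cone_form.
    have h1 := mulr_ge0 (ltW a0) (dot_ge0 (cx e)).
    have h2 := mulr_ge0 (ltW g0) (dot_ge0 (cx e)).
    have h3 := mulr_ge0 (ltW b0) (dot_ge0 (cx e)).
    have h4 := mulr_ge0 (ltW g0) (dot_ge0 (cy e)).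
    have h5 := mulr_ge0 (ltW b0) (dot_ge0 (ct e)).
    have gb : 0 < g + b by rewrite addr_gt0.
    by move: eL2; rewrite -(ler_pM2l gb); lra.
  have := ler_wpM2l t0 ce; have := ler_wpM2r (sqr_ge0 (enorm d)) tm; lra.
apply: le_trans h1 _.
rewrite -de /cone_form /step !(ctB, cxB, cyB) !joinE.
have ht := clamp_nexp (ct (p + tau *: f p)) (ct (q + tau *: f q)) Rc0.
have hy := clamp_nexp (cy (p + tau *: f p)) (cy (q + tau *: f q)) (ltW r0).
rewrite lerD ?lerN2//; last first.
  by rewrite ler_pM2l// -!enorm_sq ler_sqr ?nnegrE ?enorm_ge0.
rewrite lerD ?lerN2// ler_pM2l// -!enorm_sq ler_sqr ?nnegrE ?enorm_ge0//.
Qed.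

(** The horizontal discs on which the graph transform acts. *)
Definition horizontal (h : 'cV[R]_u -> 'cV[R]_n) :=
  (forall x, enorm x <= r -> cx (h x) = x /\ box (h x)) /\
  (forall x y, enorm x <= r -> enorm y <= r ->
     0 <= cone (h x - h y) (h x - h y)).

Let C := 1 + a / g + a / b.

(** The clamped map below is a contraction of the ball. At its fixed point the
    clamp is inactive: otherwise the point lies on the sphere, where outflow
    makes the unclamped step leave the ball. *)
Lemma step_cover tau h x' : 0 < tau -> tau * L * C <= 2^-1 ->
  horizontal h -> enorm x' <= r ->
  exists2 x, enorm x <= r & cx (step tau (h x)) = x'.
Proof.
move=> t0 tC [hb hc] x'r.
pose G x := clamp r (x' - tau *: cx (f (h x))).
have [|||x xr Gx] := @contraction_fixpoint R u r G 2^-1 (ltW r0).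
- by rewrite invr_ge0 ler0n invf_lt1 ?ltr1n.
- by move=> x _; apply: clamp_le; exact: ltW.
- move=> x y xr yr; rewrite /G (le_trans (clamp_nexp _ _ (ltW r0)))//.
  have -> : x' - tau *: cx (f (h x)) - (x' - tau *: cx (f (h y))) =
     - (tau *: cx (f (h x) - f (h y))).
    by rewrite cxB scalerBr !opprB addrC addrA subrK.
  rewrite enormN enormZ gtr0_norm//.
  have [hx bx] := hb x xr; have [hy by'] := hb y yr.
  have h1 := cx_le F (f (h x) - f (h y)).
  have h2 := f_lip bx by'.
  have := cone_enorm a0 g0 b0 (hc x y xr yr).
  rewrite cxB hx hy -/C => h3.
  apply: (@le_trans _ _ (tau * (L * (C * enorm (x - y))))).
    rewrite ler_pM2l// (le_trans h1)// (le_trans h2)// ler_pM2l//.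
  by rewrite !mulrA ler_wpM2r ?enorm_ge0.
exists x => //; have [hx bx] := hb x xr.
rewrite /step joinE !compE hx.
move: Gx; rewrite /G; set w := x' - _ => Gx.
have wr : enorm w <= r.
  rewrite leNgt; apply/negP => rw.
  have w0 : 0 < enorm w := lt_trans r0 rw.
  move: Gx; rewrite /clamp leNgt rw /= => xw.
  have xrr : enorm x = r.
    by rewrite -xw enormZ ger0_norm ?divr_ge0 ?enorm_ge0 ?divfK ?gt_eqF// ltW.
  have := f_out bx; rewrite hx => /(_ xrr) fo.
  have : dot w x = r * enorm w.
    rewrite -[in LHS]xw dotZr -enorm_sq expr2 mulrA divfK ?gt_eqF//.
  have := dot_enorm x' x; rewrite xrr.
  have : r * r < r * enorm w by rewrite ltr_pM2l.
  have : enorm x' * r <= r * r by rewrite ler_pM2r.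
  have := mulr_gt0 t0 fo; rewrite {3}/w !dotE (dotC x); lra.
move: Gx; rewrite clamp_id// => Gx.
by rewrite -[X in X + _]Gx /w subrK.
Qed.

(** Graph transform: by [step_cover] the image of a disc lies over the whole
    [x] ball, and by [step_cone] its chords stay in the cone. *)
Lemma step_horizontal tau h : 0 < tau -> tau * ((g + b) * L ^+ 2) <= 2 * m ->
  tau * L * C <= 2^-1 -> horizontal h ->
  exists2 h', horizontal h' &
    forall x', enorm x' <= r -> exists2 x, enorm x <= r & h' x' = step tau (h x).
Proof.
move=> t0 tm tC hh.
have /choice[k kP] : forall x', exists x, enorm x' <= r ->
    enorm x <= r /\ cx (step tau (h x)) = x'.
  move=> x'; have [x'r|] := boolP (enorm x' <= r); last by exists 0.
  by have [x xr hx] := step_cover t0 tC hh x'r; exists x.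
exists (fun x' => step tau (h (k x'))); last first.
  by move=> x' /kP[kr _]; exists (k x').
split=> [x' x'r|x y xr yr].
  have [_ kx] := kP _ x'r; split=> //; split; last first.
  - by rewrite /step joinE clamp_le// ltW.
  - by rewrite kx.
  - by rewrite /step joinE clamp_le.
have [kxr _] := kP _ xr; have [kyr _] := kP _ yr.
apply: step_cone => //; first exact: ltW.
- by case: (hh.1 _ kxr).
- by case: (hh.1 _ kyr).
- exact: hh.2.
Qed.

(** Any point of the [N]-th transformed disc is the end of a confined orbit
    that starts on [h]. *)
Lemma euler_horizontal tau N h : 0 < tau ->
  tau * ((g + b) * L ^+ 2) <= 2 * m -> tau * L * C <= 2^-1 -> horizontal h ->
  exists2 x, enorm x <= r & forall k, (k <= N)%N -> box (iter k (step tau) (h x)).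
Proof.
move=> t0 tm tC; elim: N h => [|N IH] h hh.
  exists 0 => [|k]; first by rewrite enorm0 ltW.
  rewrite leqn0 => /eqP ->; apply: (hh.1 0 _).2.
  by rewrite enorm0 ltW.
have [h' hh' hP] := step_horizontal t0 tm tC hh.
have [x' x'r xP] := IH h' hh'.
have [x xr hx] := hP x' x'r; exists x => // -[_|k kN].
  exact: (hh.1 x xr).2.
by rewrite iterSr -hx; exact: xP.
Qed.

(** The slice over [(th, y)] is the simplest horizontal disc. *)
Lemma euler_orbit : exists2 t1, 0 < t1 & forall tau N th y,
  0 < tau <= t1 -> enorm th <= Rc -> enorm y <= r ->
  exists2 x, enorm x <= r &
    forall k, (k <= N)%N -> box (iter k (step tau) (join F th x y)).
Proof.
have gb : 0 < (g + b) * L ^+ 2 by rewrite mulr_gt0 ?addr_gt0 ?exprn_gt0.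
have LC : 0 < L * C.
  have ag : 0 < a / g by rewrite divr_gt0.
  have ab : 0 < a / b by rewrite divr_gt0.
  by rewrite mulr_gt0// /C; lra.
exists (Num.min (2 * m / ((g + b) * L ^+ 2)) (2^-1 / (L * C))).
  rewrite lt_min (divr_gt0 (mulr_gt0 (ltr0Sn _ 1) m0) gb)/=.
  by rewrite divr_gt0 ?invr_gt0.
move=> tau N th y /andP[t0]; rewrite le_min => /andP[+ +] thR yr.
rewrite !ler_pdivlMr// => tm tC.
apply: (@euler_horizontal tau N (fun x => join F th x y)) => //.
  by rewrite -mulrA.
split=> [x xr|x x' xr x'r]; first by split; [exact: cx_join|split; rewrite !joinE].
rewrite /cone_form !compE !joinE !subrr !dot0l !mulr0 !subr0.
by rewrite mulr_ge0 ?dot_ge0// ltW.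
Qed.

(** Cluster point of the initial conditions as the step tends to zero and the
    time horizon to infinity. *)
Lemma euler_limit th y : enorm th <= Rc -> enorm y <= r ->
  exists2 x, enorm x <= r & forall e T, 0 < e -> exists tau x',
    [/\ 0 < tau < e, enorm x' <= r, enorm (x' - x) < e &
      forall k, k%:R * tau <= T -> box (iter k (step tau) (join F th x' y))].
Proof.
move=> thR yr; have [t1 t10 H] := euler_orbit.
pose tau (j : nat) := t1 / j.+1%:R.
have /choice[w wP] : forall j : nat, exists x, enorm x <= r /\
    forall k, (k <= j.+1 * j.+1)%N -> box (iter k (step (tau j)) (join F th x y)).
  move=> j; have [|x xr hx] := H (tau j) (j.+1 * j.+1)%N th y _ thR yr.
    rewrite /tau divr_gt0//= ler_pdivrMr//.
    by rewrite ler_peMr ?ler1n// ltW.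
  by exists x.
have [x xr cl] := enorm_cluster (fun j => (wP j).1).
exists x => // e T e0.
pose N := maxn (Num.truncn (t1 / e)).+1 (Num.truncn (`|T| / t1)).+1.
have [j Nj wj] := cl e N e0.
move: Nj; rewrite geq_max => /andP[N1 N2].
exists (tau j), (w j); split=> //.
- rewrite /tau divr_gt0//= ltr_pdivrMr// mulrC -ltr_pdivrMr//.
  rewrite (lt_le_trans (truncnS_gt _))// ler_nat (leq_trans N1)//.
- by case: (wP j).
move=> k kT; apply: (wP j).2; rewrite -(ler_nat R) natrM.
have tj : 0 < tau j by rewrite divr_gt0.
rewrite -(ler_pM2r tj) (le_trans kT)// /tau.
rewrite (_ : _ * (t1 / _) = j.+1%:R * t1); last first.
  by rewrite -mulrA [_ * (t1 / _)]mulrC divfK// pnatr_eq0.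
rewrite (le_trans (ler_norm _))//.
rewrite -ler_pdivrMr//; apply/ltW/(lt_le_trans (truncnS_gt _)).
by rewrite ler_nat (leq_trans N2).
Qed.

End Euler.

(** * Orbits that stay in the box *)

Lemma stay_in_ball (R : realType) n (z : R -> 'cV[R]_n) (t r : R) v :
  is_derive t (1 : R) z v -> enorm (z t) <= r ->
  (enorm (z t) = r -> dot (z t) v < 0) ->
  exists2 e, 0 < e & forall s, t < s < t + e -> enorm (z s) <= r.
Proof.
move=> dz; rewrite le_eqVlt => /predU1P[zr /(_ zr) zv|zr _].
  have := is_deriveN (is_derive_dot dz dz); rewrite (dotC v).
  move=> /is_derive_right_gt-/(_ 0)[|e e0 he]; first by lra.
  exists e => // s /he; rewrite mul0r addr0 /= => h.
  rewrite -ler_sqr ?nnegrE ?enorm_ge0// -?zr ?enorm_ge0// !enorm_sq.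
  by move: h; rewrite /GRing.opp /=; lra.
have [|e e0 he] := is_derive_near dz (e := r - enorm (z t)); first by lra.
exists e => // s ts; have := he s; rewrite gtr0_norm; last by lra.
move=> /(_ ltac:(lra)); have := enormD (z s - z t) (z t); rewrite subrK; lra.
Qed.

(** Discrete Gronwall inequality. *)
Lemma recurrence_bound (R : realFieldType) (E : nat -> R) (l d : R) :
  0 <= l -> 0 <= d ->
  forall N, (forall k, (k < N)%N -> E k.+1 <= (1 + l) * E k + d) ->
  E N <= (1 + l) ^+ N * (E 0%N + N%:R * d).
Proof.
move=> l0 d0; elim=> [|N IH] H; first by rewrite mul0r addr0 mul1r.
have {}IH := IH (fun k kN => H k (ltnW kN)).
apply: le_trans (H N (ltnSn _)) _.
have h1 : 1 <= (1 + l) ^+ N.+1 by rewrite exprn_ege1// lerDl.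
have l1 : 0 <= 1 + l by lra.
have := ler_wpM2l l1 IH; have := ler_wpM2r d0 h1.
by rewrite mul1r mulrA -exprS -natr1; lra.
Qed.

(** An orbit [q] of [f] started at [p], with [S t] meaning that it is defined
    and confined to the box at time [t]. *)
Record tracked (R : realType) n c u s (F : frame R n c u s) (Rc r : R)
    (f : 'cV[R]_n -> 'cV[R]_n) (p : 'cV[R]_n) (q : R -> 'cV[R]_n)
    (S : R -> Prop) : Prop := Tracked {
  tracked_start : q 0 = p;
  tracked_S0 : S 0;
  tracked_ode : forall t : R, S t ->
    box F Rc r (q t) /\ is_derive t (1 : R) q (f (q t));
  tracked_lim : forall t : R, 0 < t -> (forall s, 0 <= s < t -> S s) -> S t;
  tracked_ext : forall t : R, 0 <= t -> S t ->
    exists2 e, 0 < e & forall s, t < s < t + e -> box F Rc r (q s) -> S s;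
  tracked_side : forall t : R, 0 <= t -> S t -> enorm (ct F (q t)) < Rc }.

Section Trapped.
Variables (R : realType) (n c u s : nat) (F : frame R n c u s).
Variables (Rc r : R) (f : 'cV[R]_n -> 'cV[R]_n) (L M : R).
Local Notation ct := (ct F).
Local Notation cx := (cx F).
Local Notation cy := (cy F).
Local Notation box := (box F Rc r).
Local Notation step := (step F Rc r f).
Hypotheses (Rc0 : 0 <= Rc) (r0 : 0 < r) (L0 : 0 < L) (M0 : 0 < M).
Hypothesis f_lip : forall p q, box p -> box q ->
  enorm (f p - f q) <= L * enorm (p - q).
Hypothesis f_bnd : forall p, box p -> enorm (f p) <= M.
Hypothesis f_out : forall p, box p -> enorm (cx p) = r ->
  0 < dot (cx p) (cx (f p)).
Hypothesis f_in : forall p, box p -> enorm (cy p) = r ->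
  dot (cy p) (cy (f p)) < 0.

Section Orbit.
Variables (q : R -> 'cV[R]_n) (S : R -> Prop).
Hypothesis qS : forall t : R, S t -> box (q t) /\ is_derive t (1 : R) q (f (q t)).

Lemma orbit_lip (t1 t2 : R) : t1 <= t2 -> (forall t, t1 <= t <= t2 -> S t) ->
  enorm (q t2 - q t1) <= M * (t2 - t1).
Proof.
move=> t12 St.
have := @mean_value_ineq _ _ q (f \o q) t1 t2 0 M t12.
rewrite scaler0 subr0; apply=> [t /St/qS[]//|t /St/qS[bq _]].
by rewrite subr0; exact: f_bnd.
Qed.

Lemma euler_local_error (t tau : R) : 0 <= tau ->
  (forall t', t <= t' <= t + tau -> S t') ->
  enorm (q t + tau *: f (q t) - q (t + tau)) <= L * M * tau * tau.
Proof.
move=> tau0 St.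
have := @mean_value_ineq _ _ q (f \o q) t (t + tau) (f (q t)) (L * M * tau).
rewrite (_ : t + tau - t = tau); last by rewrite addrAC subrr add0r.
move=> MV; rewrite enormB opprD addrA; apply: MV.
- by rewrite lerDl.
- by move=> t' /St/qS[].
move=> t' tt'; have St' := St _ tt'.
have St0 : S t by apply: St; lra.
apply: le_trans (f_lip (qS St').1 (qS St0).1) _.
rewrite -mulrA ler_pM2l//.
apply: le_trans (orbit_lip _ _) _; first by lra.
  by move=> t'' h; apply: St; lra.
by rewrite ler_pM2l//; lra.
Qed.

(** Each step adds an error of order [tau ^+ 2]; clamping does not add to it,
    because the true orbit lies in the box. *)
Lemma euler_close T tau k p : 0 <= tau -> (forall t, 0 <= t <= T -> S t) ->
  k%:R * tau <= T -> (forall i, (i <= k)%N -> box (iter i (step tau) p)) ->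
  enorm (iter k (step tau) p - q (k%:R * tau)) <=
    expR (L * T) * (enorm (p - q 0) + T * (L * M * tau)).
Proof.
move=> tau0 St kT bi.
have T0 : 0 <= T by apply: le_trans kT; rewrite mulr_ge0.
pose E i := enorm (iter i (step tau) p - q (i%:R * tau)).
have d0 : 0 <= L * M * tau * tau by rewrite !mulr_ge0// ltW.
have l0 : 0 <= tau * L by rewrite mulr_ge0// ltW.
have H i : (i < k)%N -> E i.+1 <= (1 + tau * L) * E i + L * M * tau * tau.
  move=> ik.
  have iT : i%:R * tau + tau <= T.
    by apply: le_trans kT; rewrite -{2}(mul1r tau) -mulrDl natr1 ler_wpM2r// ler_nat.
  have i0 : 0 <= i%:R * tau by rewrite mulr_ge0.
  rewrite /E -natr1 mulrDl mul1r iterS.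
  have [bq _] := qS (St (i%:R * tau) ltac:(lra)).
  have [bq' _] := qS (St (i%:R * tau + tau) ltac:(lra)).
  have bp := bi i (ltnW ik).
  set p' := iter i _ p in bp *; set t := i%:R * tau in bq bq' i0 iT *.
  apply: le_trans (step_dist f tau p' bq') _.
  apply: le_trans (enormDB (q t + tau *: f (q t)) _ _) _.
  apply: lerD; last first.
    by apply: euler_local_error => // t' h; apply: St; lra.
  rewrite opprD addrACA -scalerBr (le_trans (enormD _ _))//.
  rewrite enormZ ger0_norm// mulrDl mul1r lerD2l -mulrA ler_wpM2l//.
  exact: f_lip.
have := recurrence_bound l0 d0 H; rewrite /E mul0r => h.
apply: le_trans h _; apply: ler_pM.
- by rewrite exprn_ge0// addr_ge0.
- by rewrite addr_ge0 ?enorm_ge0// mulr_ge0.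
- have := expR_ge1Dx (tau * L) => h.
  have h2 : (1 + tau * L) ^+ k <= expR (tau * L) ^+ k.
    by rewrite lerXn2r ?nnegrE ?addr_ge0// expR_ge0.
  rewrite (le_trans h2)// -expRM_natl ler_expR.
  by rewrite mulrA [leRHS]mulrC ler_pM2r.
- by rewrite lerD2l [L * M * tau * tau]mulrC mulrA ler_wpM2r// !mulr_ge0// ltW.
Qed.

(** Were the true orbit to reach the sphere [|x| = r] at time [T], the
    Euler orbits that follow it up to [T] would keep gaining [x]-norm at a
    definite rate for a further time [sg] that does not shrink with the
    step, and so leave the ball. *)
Lemma no_exit th x y T : 0 <= T -> (forall t, 0 <= t <= T -> S t) ->
  q 0 = join F th x y ->
  (forall e T', 0 < e -> exists tau x',
    [/\ 0 < tau < e, enorm x' <= r, enorm (x' - x) < e &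
      forall k, k%:R * tau <= T' -> box (iter k (step tau) (join F th x' y))]) ->
  enorm (cx (q T)) < r.
Proof.
move=> T0 St q0 H.
have [bT _] := qS (St T ltac:(lra)); have [_ xTr _] := bT.
rewrite lt_neqAle xTr andbT; apply/eqP => xT.
pose c0 := dot (cx (q T)) (cx (f (q T))).
have c00 : 0 < c0 by exact: f_out.
have rL : 0 < M + r * L by rewrite addr_gt0// mulr_gt0.
pose eta := c0 / (2 * (M + r * L)).
have eta0 : 0 < eta by rewrite divr_gt0// mulr_gt0.
have out p : box p -> enorm (p - q T) <= eta -> c0 / 2 <= dot (cx p) (cx (f p)).
  move=> bp pe.
  have : enorm (p - q T) * (M + r * L) <= c0 / 2.
    by rewrite -ler_pdivlMr// -mulrA -invfM.
  have -> : dot (cx p) (cx (f p)) =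
      c0 + dot (cx (p - q T)) (cx (f p)) + dot (cx (q T)) (cx (f p - f (q T))).
    by rewrite /c0 !cxB !dotE; ring.
  have h1 := dot_enormN (cx (p - q T)) (cx (f p)).
  have h2 := dot_enormN (cx (q T)) (cx (f p - f (q T))).
  have h3 : enorm (cx (p - q T)) * enorm (cx (f p)) <= enorm (p - q T) * M.
    rewrite ler_pM ?enorm_ge0 ?cx_le//.
    exact: le_trans (cx_le _ _) (f_bnd bp).
  have h4 : enorm (cx (q T)) * enorm (cx (f p - f (q T))) <=
      r * (L * enorm (p - q T)).
    rewrite xT ler_pM2l// (le_trans (cx_le _ _))//; exact: f_lip.
  lra.
pose sg := Num.min 1 (eta / (2 * M)).
have sg0 : 0 < sg by rewrite lt_min ltr01 divr_gt0// mulr_gt0.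
have sg1 : sg <= 1 by rewrite ge_min lexx.
have sgM : sg * M <= eta / 2.
  by rewrite -ler_pdivlMr// -mulrA -invfM ge_min lexx orbT.
pose om := Num.min (eta / 2) (sg * c0 / (8 * r)).
have om0 : 0 < om by rewrite lt_min !divr_gt0 ?mulr_gt0.
have om1 : om <= eta / 2 by rewrite ge_min lexx.
have om2 : om * (8 * r) <= sg * c0.
  by rewrite -ler_pdivlMr ?mulr_gt0// ge_min lexx orbT.
pose K := expR (L * T) * (1 + T * (L * M)) + M.
have LM0 : 0 < L * M by rewrite mulr_gt0.
have TLM : 0 <= T * (L * M) by rewrite mulr_ge0// ltW.
have K0 : 0 < K by rewrite addr_gt0// mulr_gt0 ?expR_gt0// ltr_wpDr.
pose e := Num.min (sg / 2) (om / K).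
have e0 : 0 < e by rewrite lt_min !divr_gt0.
have [tau [x' [/andP[tau0 taue] x'r x'x bi]]] := H e (T + 1) e0.
have tau_sg : tau < sg / 2 by move: taue; rewrite lt_min => /andP[].
have eK : e * K <= om by rewrite -ler_pdivlMr// ge_min lexx orbT.
pose k := Num.truncn (T / tau).
have /andP[] : k%:R <= T / tau < k.+1%:R.
  by apply: truncn_itv; apply: divr_ge0 => //; exact: ltW.
rewrite ler_pdivlMr// ltr_pdivrMr// -natr1 mulrDl mul1r => kT Tk.
set p0 := join F th x' y in bi.
pose p i := iter (k + i) (step tau) p0.
have pk : enorm (p 0%N - q T) <= om.
  have h1 : enorm (p 0%N - q (k%:R * tau)) <=
      expR (L * T) * (enorm (p0 - q 0) + T * (L * M * tau)).
    rewrite /p addn0; apply: euler_close => //; first exact: ltW.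
    move=> i ik; apply: bi; apply: le_trans (_ : _ <= k%:R * tau) _; last by lra.
    by rewrite ler_pM2r// ler_nat.
  have h2 : enorm (q (k%:R * tau) - q T) <= M * tau.
    rewrite enormB; apply: le_trans (orbit_lip kT _) _.
      move=> t ht; apply: St.
      by have : 0 <= k%:R * tau; [rewrite mulr_ge0// ltW|lra].
    by rewrite ler_pM2l//; lra.
  have h3 : enorm (p0 - q 0) <= e.
    rewrite q0 -ler_sqr ?nnegrE ?enorm_ge0 ?ltW// (enorm_comp F).
    rewrite !(ctB, cxB, cyB) !joinE !subrr !enorm0 !expr0n addr0 add0r.
    by rewrite ltr_sqr ?nnegrE ?enorm_ge0// ltW.
  apply: le_trans (enormDB (q (k%:R * tau)) _ _) _.
  apply: le_trans (lerD h1 h2) (le_trans _ eK).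
  rewrite /K [leRHS]mulrDr lerD//; last by rewrite mulrC ler_pM2r// ltW.
  rewrite [leRHS]mulrCA ler_wpM2l ?expR_ge0// [leRHS]mulrDr mulr1 lerD//.
  by rewrite [leRHS]mulrC -[leRHS]mulrA ler_wpM2l// ler_pM2l// ltW.
have pS i : p i.+1 = step tau (p i) by rewrite /p addnS iterS.
have bp i : i%:R * tau <= sg -> box (p i).
  move=> isg; apply: bi; rewrite natrD mulrDl; lra.
have lt_i i : i.+1%:R * tau <= sg -> i%:R * tau <= sg.
  by rewrite -natr1 mulrDl mul1r; lra.
have far i : i%:R * tau <= sg -> enorm (p i - p 0%N) <= i%:R * tau * M.
  elim: i => [|i IH isg]; first by rewrite subrr enorm0 !mul0r.
  have bpi := bp i (lt_i i isg).
  apply: le_trans (enormDB (p i) _ _) _.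
  have -> : i.+1%:R * tau * M = tau * M + i%:R * tau * M.
    by rewrite -natr1 !mulrDl mul1r addrC.
  apply: lerD; last exact: IH (lt_i i isg).
  rewrite pS; apply: le_trans (step_dist f tau (p i) bpi) _.
  by rewrite addrC addKr enormZ gtr0_norm// ler_pM2l// f_bnd.
have grow i : i%:R * tau <= sg ->
    dot (cx (p 0%N)) (cx (p 0%N)) + i%:R * tau * c0 <= dot (cx (p i)) (cx (p i)).
  elim: i => [|i IH isg]; first by rewrite !mul0r addr0.
  have isg' := lt_i i isg; have bpi := bp i isg'.
  have : c0 / 2 <= dot (cx (p i)) (cx (f (p i))).
    apply: out => //; apply: le_trans (enormDB (p 0%N) _ _) _.
    have := far i isg'; have : i%:R * tau * M <= sg * M by rewrite ler_pM2r.
    lra.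
  rewrite pS /step joinE cxD cxZ !dotE (dotC (cx (f (p i))) (cx (p i))).
  move=> h; rewrite -natr1 !(mulrDl _ _ tau) mul1r.
  have h1 := IH isg'; have h2 := ler_wpM2l (ltW tau0) h.
  have h3 := mulr_ge0 (ltW tau0) (mulr_ge0 (ltW tau0) (dot_ge0 (cx (f (p i))))).
  lra.
pose i := Num.truncn (sg / tau).
have /andP[] : i%:R <= sg / tau < i.+1%:R.
  by apply: truncn_itv; apply: divr_ge0 => //; exact: ltW.
rewrite ler_pdivlMr// ltr_pdivrMr// -natr1 mulrDl mul1r => isg sgi.
have := grow i isg; rewrite -!enorm_sq.
have [_ xi _] := bp i isg.
have : enorm (cx (p i)) ^+ 2 <= r ^+ 2.
  by rewrite lerXn2r ?nnegrE ?enorm_ge0// ltW.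
have : r - om <= enorm (cx (p 0%N)).
  have := enormD (cx (p 0%N)) (cx (q T) - cx (p 0%N)).
  rewrite addrC subrK xT -cxB; have := cx_le F (q T - p 0%N).
  by rewrite (enormB (q T)); lra.
have : (sg / 2) * c0 < i%:R * tau * c0 by rewrite ltr_pM2r//; lra.
have := mulr_gt0 sg0 c00.
move: (enorm (cx (p 0%N))) => X h1 h2 h3.
have h4 := ler_wpM2l (ltW r0) h3; have := sqr_ge0 (X - r).
clear - h1 h2 h4 om2; lra.
Qed.

End Orbit.

(** A point of the slice whose forward orbit never leaves the box. The orbit
    cannot cross [|x| = r] because it is followed by confined Euler orbits,
    [|y| = r] because the field points inwards there, and [|th| = Rc] by
    assumption. *)
Lemma trapped_orbit a g b m th y (q : 'cV[R]_u -> R -> 'cV[R]_n)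
    (S : 'cV[R]_u -> R -> Prop) :
  0 < a -> 0 < g -> 0 < b -> 0 < m ->
  (forall p p', box p -> box p' -> 0 <= cone_form F a g b (p - p') (p - p') ->
    m * enorm (p - p') ^+ 2 <= cone_form F a g b (p - p') (f p - f p')) ->
  enorm th <= Rc -> enorm y <= r ->
  (forall x, enorm x <= r -> tracked F Rc r f (join F th x y) (q x) (S x)) ->
  exists2 x, enorm x <= r & forall t, 0 <= t -> S x t.
Proof.
move=> a0 g0 b0 m0 f_cone thR yr trk.
have [x xr lim] := euler_limit a0 g0 b0 Rc0 r0 m0 L0 f_cone f_lip f_out thR yr.
exists x => //; have [q0 S0 ode Slim Sext side] := trk x xr.
apply: real_induction => // t t0 St.
have Stt := St t ltac:(lra); have [[bt bx by'] dq] := ode t Stt.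
have [||e1 e10 h1] := stay_in_ball (is_derive_rowsub (idx_t F) dq) (r := Rc).
- exact: bt.
- by move=> eq; have := side t t0 Stt; rewrite [enorm _]eq ltxx.
have [||e2 e20 h2] := stay_in_ball (is_derive_rowsub (idx_x F) dq) (r := r).
- exact: bx.
- move=> eq; have := no_exit ode t0 St q0 lim.
  by rewrite [enorm _]eq ltxx.
have [||e3 e30 h3] := stay_in_ball (is_derive_rowsub (idx_y F) dq) (r := r).
- exact: by'.
- by move=> eq; apply: (f_in (ode t Stt).1).
have [e4 e40 h4] := Sext t t0 Stt.
pose e := Num.min (Num.min e1 e2) (Num.min e3 e4).
exists e; first by rewrite !lt_min e10 e20 e30.
have : e <= e1 by rewrite !ge_min lexx.
have : e <= e2 by rewrite !ge_min lexx orbT.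
have : e <= e3 by rewrite !ge_min lexx !orbT.
have : e <= e4 by rewrite !ge_min lexx !orbT.
move=> l4 l3 l2 l1 s' hs; apply: h4; first by lra.
by split; [apply: h1|apply: h2|apply: h3]; lra.
Qed.

End Trapped.

(** * Derivative enclosures and uniform margins *)

Lemma is_derive_diff_comp (R : realType) (V W : normedModType R) (q : R -> V)
    (phi : V -> W) (t : R) v :
  is_derive t (1 : R) q v -> differentiable phi (q t) ->
  is_derive t (1 : R) (phi \o q) ('d phi (q t) v).
Proof.
move=> [dq qv] dphi; have dq' := dq; move/derivable1_diffP in dq'.
have dc : differentiable (phi \o q) t by exact: differentiable_comp.
split; first exact/derivable1_diffP.
by rewrite deriveE// diff_comp//= -qv deriveE.
Qed.

Section MatrixBounds.
Variable R : realType.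

Lemma enorm_mulmx_bounded m n (A : 'M[R]_(m, n)) B : 0 <= B ->
  (forall i j, `|A i j| <= B) -> forall x : 'cV[R]_n,
  enorm (A *m x) <= m.+1%:R * (n%:R * B) * enorm x.
Proof.
move=> B0 AB x; apply: le_trans (enorm_le_norm _) _; rewrite -!mulrA ler_wpM2l//.
rewrite [leLHS]/Num.Def.normr/= mx_normrE; apply: bigmax_le => [|[i j] _ /=].
  by rewrite !mulr_ge0 ?enorm_ge0.
rewrite (ord1 j) mxE (le_trans (ler_norm_sum _ _ _))//.
rewrite (le_trans (ler_sum _ (_ : forall k, true -> _ <= B * enorm x)))//.
  by move=> k _; rewrite normrM ler_pM ?enorm_coord.
by rewrite sumr_const card_ord mulr_natl.
Qed.

Lemma eopnorm_lt m n (A : 'M[R]_(m, n)) e (x : 'cV[R]_n) : eopnorm A < e ->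
  enorm (A *m x) <= e * enorm x.
Proof.
move=> Ae; have [x0|x0] := eqVneq (enorm x) 0.
  by rewrite (enorm_eq0 x0) mulmx0 !enorm0 mulr0.
have xp : 0 < enorm x by rewrite lt0r x0 enorm_ge0.
rewrite -ler_pdivrMr//; apply: le_trans (ltW Ae); apply: ub_le_sup.
  pose B := \sum_i \sum_j `|A i j|.
  exists (m.+1%:R * (n%:R * B)) => _ [z /= z1 <-].
  have B0 : 0 <= B by rewrite sumr_ge0// => i _; rewrite sumr_ge0.
  have AB i j : `|A i j| <= B.
    rewrite /B (bigD1 i)//= (bigD1 j)//= -addrA lerDl.
    by rewrite addr_ge0 ?sumr_ge0// => k _; rewrite sumr_ge0.
  apply: le_trans (enorm_mulmx_bounded B0 AB z) _.
  by rewrite ler_piMr// !mulr_ge0.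
exists ((enorm x)^-1 *: x) => /=.
  by rewrite enormZ gtr0_norm ?invr_gt0// mulVf.
by rewrite -scalemxAr enormZ gtr0_norm ?invr_gt0// mulrC.
Qed.

Lemma qformE n (A : 'M[R]_n) (x : 'cV[R]_n) : qform A x = dot x (A *m x).
Proof.
by rewrite /qform -mulmxA mxE; apply: eq_bigr => i _; rewrite mxE.
Qed.

Lemma qform_inf_lt n (A : 'M[R]_n) d (x : 'cV[R]_n) :
  (d%:E < qform_inf A)%E -> d * dot x x <= dot x (A *m x).
Proof.
move=> dA; have [x0|x0] := eqVneq (enorm x) 0.
  by rewrite (enorm_eq0 x0) mulmx0 dot0l mulr0.
have xp : 0 < enorm x by rewrite lt0r x0 enorm_ge0.
have : (d%:E <= (qform A ((enorm x)^-1 *: x))%:E)%E.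
  apply: le_trans (ltW dA) _; apply: ereal_inf_lbound => /=.
  exists ((enorm x)^-1 *: x) => //=.
  by rewrite enormZ gtr0_norm ?invr_gt0// mulVf.
rewrite lee_fin qformE -scalemxAr !dotE mulrA -invfM -expr2 mulrC.
by rewrite ler_pdivlMr ?exprn_gt0// enorm_sq.
Qed.

Lemma qform_sup_lt n (A : 'M[R]_n) d (x : 'cV[R]_n) :
  (qform_sup A < d%:E)%E -> dot x (A *m x) <= d * dot x x.
Proof.
move=> dA; have [x0|x0] := eqVneq (enorm x) 0.
  by rewrite (enorm_eq0 x0) mulmx0 dot0l mulr0.
have xp : 0 < enorm x by rewrite lt0r x0 enorm_ge0.
have : ((qform A ((enorm x)^-1 *: x))%:E <= d%:E)%E.
  apply: le_trans (ltW dA); apply: ereal_sup_ubound => /=.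
  exists ((enorm x)^-1 *: x) => //=.
  by rewrite enormZ gtr0_norm ?invr_gt0// mulVf.
rewrite lee_fin qformE -scalemxAr !dotE mulrA -invfM -expr2 mulrC.
by rewrite ler_pdivrMr ?exprn_gt0// enorm_sq.
Qed.

End MatrixBounds.

Section MeanValue.
Variables (R : realType) (n : nat) (f : 'cV[R]_n -> 'cV[R]_n).

Lemma jac_mul (x v : 'cV[R]_n) : differentiable f x -> 'd f x v = jac f x *m v.
Proof.
move=> dfx; apply/colP => i.
have dfd w : derivable f x w by exact: diff_derivable.
have E w : 'd f x w i 0 = 'D_w (fun q => f q i 0) x.
  by rewrite -deriveE// derive_mx// mxE.
have -> : 'd f x v i 0 = (\sum_j v j 0 *: 'd f x (delta_mx j 0)) i 0.
  rewrite {1}(matrix_sum_delta v) linear_sum; congr (fun_of_matrix _ i 0).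
  by apply: eq_bigr => j _; rewrite big_ord1 linearZ.
rewrite summxE mxE; apply: eq_bigr => j _; rewrite !mxE mulrC; congr (_ * _).
exact: E.
Qed.

(** Rows are treated one at a time, each with its own intermediate point; this
    is why the enclosure takes bounds entry by entry. *)
Lemma mean_value_enclosure (N : set 'cV[R]_n) p q :
  (forall t, 0 <= t <= 1 -> N (q + t *: (p - q))) ->
  (forall x, N x -> differentiable f x) ->
  exists A, [/\ enclosure f N A, f p - f q = A *m (p - q) &
    forall i, exists2 x, N x & row i A = row i (jac f x)].
Proof.
move=> Nseg df; set d := p - q in Nseg *.
have H i : exists2 x, N x & (f p - f q) i 0 = (jac f x *m d) i 0.
  pose l t := q + t *: d.
  have dl (t : R) : is_derive t (1 : R) l d.
    apply/is_derive_enormP => e e0; exists 1 => // s _.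
    by rewrite /l opprD addrACA subrr add0r -scalerBl subrr enorm0 mulr_ge0// ltW.
  have dfl (t : R) : 0 <= t <= 1 ->
      is_derive t (1 : R) (fun t => f (l t) i 0) ((jac f (l t) *m d) i 0).
    move=> t01; have dft := df _ (Nseg t t01).
    have /is_derive_coordP/(_ i) := is_derive_diff_comp (dl t) dft.
    by rewrite jac_mul.
  have [||x x01 gx] := @MVT_segment R (fun t => f (l t) i 0)
    (fun t => (jac f (l t) *m d) i 0) 0 1 ler01.
  - by move=> x; rewrite in_itv/= => /andP[? ?]; apply: dfl; rewrite !ltW.
  - by apply: derivable_within_continuous => x; rewrite in_itv/= => /dfl[].
  exists (l x); first by apply: Nseg; move: x01; rewrite in_itv.
  move: gx; rewrite subr0 mulr1 => <-.
  have qd : q + d = p by rewrite addrC subrK.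
  by rewrite /l scale1r scale0r addr0 qd !mxE.
have /choice[x xP] : forall i, exists x, N x /\ (f p - f q) i 0 = (jac f x *m d) i 0.
  by move=> i; have [x ? ?] := H i; exists x.
exists (\matrix_(i, j) jac f (x i) i j); split.
- move=> i j; rewrite !mxE; split.
    by apply: ereal_inf_lbound; exists (x i) => //; [case: (xP i)|rewrite mxE].
  by apply: ereal_sup_ubound; exists (x i) => //; [case: (xP i)|rewrite mxE].
- apply/colP => i; rewrite (xP i).2 !mxE.
  by apply: eq_bigr => j _; rewrite !mxE.
- move=> i; exists (x i); first by case: (xP i).
  by apply/rowP => j; rewrite !mxE.
Qed.

Lemma C1_lipschitz (K : set 'cV[R]_n) : compact K -> C1_on K f ->
  (forall p q t, K p -> K q -> 0 <= t <= 1 -> K (q + t *: (p - q))) ->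
  exists2 L, 0 < L & forall p q, K p -> K q -> enorm (f p - f q) <= L * enorm (p - q).
Proof.
move=> cK fK convK.
have : compact (jac f @` K).
  apply: continuous_compact => //; apply: continuous_in_subspaceT => x /set_mem /fK.
  by case.
move=> /compact_bounded[B1 [_ /(_ (B1 + 1))]]; rewrite ltrDl ltr01 => /(_ isT).
set B := B1 + 1 => BP.
pose B' := Num.max B 0.
have B0 : 0 <= B' by rewrite le_max lexx orbT.
have jB x i j : K x -> `|jac f x i j| <= B'.
  move=> Kx; apply: (@le_trans _ _ B); last by rewrite le_max lexx.
  apply: le_trans (BP (jac f x) _); last by exists x.
  rewrite [leRHS]/Num.Def.normr/= mx_normrE.
  exact: (le_bigmax _ (fun p : 'I_n * 'I_n => `|jac f x p.1 p.2|) (i, j)).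
exists (n.+1%:R * (n%:R * B') + 1).
  by rewrite ltr_wpDl// !mulr_ge0.
move=> p q Kp Kq.
have [A [_ -> AP]] := mean_value_enclosure (fun t => convK p q t Kp Kq)
  (fun x Kx => (fK x Kx).1).
apply: le_trans (enorm_mulmx_bounded B0 _ _) _.
  move=> i j; have [x Kx /rowP/(_ j)] := AP i; rewrite !mxE => ->.
  by have := jB x i j Kx; rewrite mxE.
by rewrite ler_wpM2r ?enorm_ge0// lerDl.
Qed.

End MeanValue.

(** With [Q = a X - g T - b Y] the right-hand side is
    [lx Q + (lx - lt) g T + (lx - ly) b Y], where all coefficients are positive;
    and [Q + g T + b Y = a X] controls half of [a X + g T + b Y] in the cone. *)
Lemma cone_margin (R : realFieldType) (a g b lx lt ly : R) :
  0 < a -> 0 < g -> 0 < b -> 0 < lx -> lt < lx -> ly < lx ->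
  exists2 mu, 0 < mu & forall X T Y, 0 <= X -> 0 <= T -> 0 <= Y ->
    0 <= a * X - g * T - b * Y ->
    mu * (T + X + Y) <= lx * (a * X) - lt * (g * T) - ly * (b * Y).
Proof.
move=> a0 g0 b0 l0 tx yx.
pose m1 := Num.min lx (Num.min (lx - lt) (lx - ly)).
have m10 : 0 < m1 by rewrite !lt_min l0 !subr_gt0 tx yx.
have m1x : m1 <= lx by rewrite ge_min lexx.
have m1t : m1 <= lx - lt by rewrite !ge_min lexx orbT.
have m1y : m1 <= lx - ly by rewrite !ge_min lexx !orbT.
pose m2 := Num.min a (Num.min g b).
have m20 : 0 < m2 by rewrite !lt_min a0 g0.
have m2x : m2 <= a by rewrite ge_min lexx.
have m2t : m2 <= g by rewrite !ge_min lexx orbT.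
have m2y : m2 <= b by rewrite !ge_min lexx !orbT.
exists (m1 / 2 * m2); first by rewrite mulr_gt0// divr_gt0.
move=> X T Y X0 T0 Y0; set Q := _ - b * Y => Q0.
have gT := mulr_ge0 (ltW g0) T0; have bY := mulr_ge0 (ltW b0) Y0.
have h1 : m2 * (T + X + Y) <= a * X + g * T + b * Y.
  have := ler_wpM2r X0 m2x; have := ler_wpM2r T0 m2t; have := ler_wpM2r Y0 m2y.
  lra.
have h2 := ler_wpM2l (ltW m10) h1.
have h3 := ler_wpM2r Q0 m1x; have h4 := ler_wpM2r gT m1t; have h5 := ler_wpM2r bY m1y.
have h6 := mulr_ge0 (ltW m10) Q0.
rewrite /Q in Q0 h3 h6; lra.
Qed.

(** A positive quantity attached to every centre is bounded below once each
    centre may be traded for a nearby one: a sequence of centres with margins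
    tending to zero would cluster at a centre with none. *)
Lemma uniform_margin (R : realType) n (Rc rho : R) (P : 'cV[R]_n -> R -> Prop) :
  0 < rho -> (forall th, enorm th <= Rc -> exists2 mu, 0 < mu & P th mu) ->
  exists2 m, 0 < m & forall th, enorm th <= Rc ->
    exists th' mu, [/\ enorm th' <= Rc, enorm (th - th') < rho, m <= mu & P th' mu].
Proof.
move=> rho0 HP; apply: contrapT => nex.
have /choice[w wP] : forall k : nat, exists th, enorm th <= Rc /\
    ~ exists th' mu, [/\ enorm th' <= Rc, enorm (th - th') < rho,
        k.+1%:R^-1 <= mu & P th' mu].
  move=> k; apply: contrapT => nth; apply: nex.
  exists k.+1%:R^-1; first by rewrite invr_gt0.
  by move=> th thR; apply: contrapT => nn; apply: nth; exists th.
have [l lR cl] := enorm_cluster (fun k => (wP k).1).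
have [mu mu0 Pmu] := HP l lR.
have [k kN wl] := cl rho (Num.truncn mu^-1) rho0.
apply: (wP k).2; exists l, mu; split=> //.
rewrite -[leRHS]invrK lef_pV2 ?posrE ?invr_gt0//.
by rewrite (le_trans (ltW (truncnS_gt _)))// ler_nat.
Qed.

(** * The blocks of the derivative *)

Section UniformCone.
Variables (R : realType) (n c u s : nat) (F : frame R n c u s).
Variables (a g b Rc r rho : R) (f : 'cV[R]_n -> 'cV[R]_n).
Local Notation cone := (cone_form F a g b).
Local Notation box := (box F Rc r).

(** Two points of the box whose difference lies in the cone are close in the
    [th] direction, so both lie over every ball of radius [rho] centred near
    their midpoint. *)
Lemma uniform_cone : 0 < a -> 0 < g -> 0 < b -> 0 <= Rc -> 0 <= r ->
  r * Num.sqrt (a / g) < rho ->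
  (forall th, enorm th <= Rc -> exists2 mu, 0 < mu & forall p q,
     box p -> box q -> enorm (ct F p - th) <= rho -> enorm (ct F q - th) <= rho ->
     0 <= cone (p - q) (p - q) ->
     mu * enorm (p - q) ^+ 2 <= cone (p - q) (f p - f q)) ->
  exists2 m, 0 < m & forall p q, box p -> box q -> 0 <= cone (p - q) (p - q) ->
     m * enorm (p - q) ^+ 2 <= cone (p - q) (f p - f q).
Proof.
move=> a0 g0 b0 Rc0 r0 rrho /uniform_margin.
set w := Num.sqrt _ in rrho.
have w0 : 0 <= w by exact: sqrtr_ge0.
move=> /(_ (rho - r * w)); rewrite subr_gt0 => /(_ rrho)[m m0 H].
exists m => // p q bp bq pq.
pose th := 2^-1 *: (ct F p + ct F q).
have [tp xp _] := bp; have [tq xq _] := bq.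
have thR : enorm th <= Rc.
  rewrite enormZ gtr0_norm// ler_pdivrMl// (le_trans (enormD _ _))//; lra.
have dth : enorm (ct F p - ct F q) <= 2 * (r * w).
  rewrite -ctB enorm_le ?mulr_ge0// !exprMn /w sqr_sqrtr; last first.
    by rewrite divr_ge0 ?ltW.
  have : dot (cx F (p - q)) (cx F (p - q)) <= (2 * r) ^+ 2.
    rewrite -enorm_le ?mulr_ge0// cxB (le_trans (enormD _ _))// enormN; lra.
  rewrite -(ler_pM2l a0) => h.
  rewrite mulrA -exprMn mulrA ler_pdivlMr//.
  move: pq; rewrite /cone_form.
  have := mulr_ge0 (ltW b0) (dot_ge0 (cy F (p - q))); lra.
have [th' [mu [th'R thth' mmu Pmu]]] := H th thR.
have near x y : enorm (x - y) <= 2 * (r * w) -> th = 2^-1 *: (x + y) ->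
    enorm (x - th') <= rho.
  move=> xy thE; have -> : x - th' = 2^-1 *: (x - y) + (th - th').
    by rewrite thE; apply/colP => i; rewrite !mxE; field.
  by rewrite (le_trans (enormD _ _))// enormZ gtr0_norm//; lra.
apply: le_trans (Pmu p q bp bq (near _ _ dth erefl) _ pq).
  by rewrite ler_wpM2r ?sqr_ge0.
by apply: (near _ (ct F p)); [rewrite enormB|rewrite /th addrC].
Qed.

End UniformCone.

Section AlignedFrames.
Variables (R : realType) (c u s : nat).
Implicit Types p q d : 'cV[R]_(c + (u + s)).

Lemma dot_split p q : dot p q = dot (pi_th p) (pi_th q) +
  dot (pi_x p) (pi_x q) + dot (pi_y p) (pi_y q).
Proof.
rewrite /dot big_split_ord/= -addrA big_split_ord/=.
by congr (_ + (_ + _)); apply: eq_bigr => i _; rewrite !mxE.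
Qed.

Lemma pi_thE p : pi_th p = rowsub (lshift (u + s)) p.
Proof. by rewrite /pi_th usubmxEsub. Qed.

Lemma pi_xE p : pi_x p = rowsub (fun i => rshift c (lshift s i)) p.
Proof. by apply/colP => i; rewrite !mxE. Qed.

Lemma pi_yE p : pi_y p = rowsub (fun i => rshift c (rshift u i)) p.
Proof. by apply/colP => i; rewrite !mxE. Qed.

Definition join3 (th : 'cV[R]_c) (x : 'cV[R]_u) (y : 'cV[R]_s) :
  'cV[R]_(c + (u + s)) := col_mx th (col_mx x y).

Lemma pi_th_join th x y : pi_th (join3 th x y) = th.
Proof. by rewrite /pi_th col_mxKu. Qed.

Lemma pi_x_join th x y : pi_x (join3 th x y) = x.
Proof. by rewrite /pi_x col_mxKd col_mxKu. Qed.

Lemma pi_y_join th x y : pi_y (join3 th x y) = y.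
Proof. by rewrite /pi_y !col_mxKd. Qed.

Lemma join3_pi p : join3 (pi_th p) (pi_x p) (pi_y p) = p.
Proof. by rewrite /join3 /pi_x /pi_y !vsubmxK. Qed.

Let embed_x (i : 'I_u) : 'I_(c + (u + s)) := rshift c (lshift s i).
Let embed_y (i : 'I_s) : 'I_(c + (u + s)) := rshift c (rshift u i).

Let join_th th x y : rowsub (lshift (u + s)) (join3 th x y) = th.
Proof. by rewrite -pi_thE pi_th_join. Qed.
Let join_x th x y : rowsub embed_x (join3 th x y) = x.
Proof. by rewrite -pi_xE pi_x_join. Qed.
Let join_y th x y : rowsub embed_y (join3 th x y) = y.
Proof. by rewrite -pi_yE pi_y_join. Qed.

Let dot_embed p q : dot p q =
  dot (rowsub (lshift (u + s)) p) (rowsub (lshift (u + s)) q)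
  + dot (rowsub embed_x p) (rowsub embed_x q)
  + dot (rowsub embed_y p) (rowsub embed_y q).
Proof. by rewrite -!pi_thE -!pi_xE -!pi_yE dot_split. Qed.

Let dot_embedC p q : dot p q =
  dot (rowsub (lshift (u + s)) p) (rowsub (lshift (u + s)) q)
  + dot (rowsub embed_y p) (rowsub embed_y q)
  + dot (rowsub embed_x p) (rowsub embed_x q).
Proof. by rewrite dot_embed addrAC. Qed.

Definition forward_frame : frame R (c + (u + s)) c u s :=
  Frame join_th join_x join_y dot_embed.

(** Reversing time exchanges the roles of the [x] and [y] directions. *)
Definition backward_frame : frame R (c + (u + s)) c s u :=
  @Frame R _ c s u (lshift (u + s)) embed_y embed_x (fun th y x => join3 th x y)
    (fun th y x => join_th th x y) (fun th y x => join_y th x y)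
    (fun th y x => join_x th x y) dot_embedC.

Lemma fwdE p : (ct forward_frame p = pi_th p) * (cx forward_frame p = pi_x p)
  * (cy forward_frame p = pi_y p).
Proof. by rewrite pi_thE pi_xE pi_yE. Qed.

Lemma bwdE p : (ct backward_frame p = pi_th p) * (cx backward_frame p = pi_y p)
  * (cy backward_frame p = pi_x p).
Proof. by rewrite pi_thE pi_xE pi_yE. Qed.

Lemma box_fwdE Rc r : box forward_frame Rc r = Dphi Rc r.
Proof.
by apply/seteqP; split=> p; rewrite /box/= !fwdE /Dphi /prod3 /cball/= !subr0.
Qed.

Lemma box_bwdE Rc r : box backward_frame Rc r = Dphi Rc r.
Proof.
apply/seteqP; split=> p; rewrite /box/= !bwdE /Dphi /prod3 /cball/= !subr0.
  by case.
by case.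
Qed.

Lemma pi_th_mul (A : 'M[R]_(c + (u + s))) d : pi_th (A *m d) =
  ulsubmx A *m pi_th d + lsubmx (ursubmx A) *m pi_x d + rsubmx (ursubmx A) *m pi_y d.
Proof.
rewrite -{1}(submxK A) -{1}(vsubmxK d) /pi_th mul_block_col col_mxKu.
by rewrite -{1}(hsubmxK (ursubmx A)) -{1}(vsubmxK (dsubmx d)) mul_row_col addrA.
Qed.

Lemma pi_x_mul (A : 'M[R]_(c + (u + s))) d : pi_x (A *m d) =
  usubmx (dlsubmx A) *m pi_th d + ulsubmx (drsubmx A) *m pi_x d
    + ursubmx (drsubmx A) *m pi_y d.
Proof.
rewrite -{1}(submxK A) -{1}(vsubmxK d) /pi_x mul_block_col col_mxKd.
rewrite -{1}(submxK (drsubmx A)) -{1}(vsubmxK (dsubmx d)) mul_block_col.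
by rewrite -{1}(vsubmxK (dlsubmx A)) mul_col_mx add_col_mx col_mxKu addrA.
Qed.

Lemma pi_y_mul (A : 'M[R]_(c + (u + s))) d : pi_y (A *m d) =
  dsubmx (dlsubmx A) *m pi_th d + dlsubmx (drsubmx A) *m pi_x d
    + drsubmx (drsubmx A) *m pi_y d.
Proof.
rewrite -{1}(submxK A) -{1}(vsubmxK d) /pi_y mul_block_col col_mxKd.
rewrite -{1}(submxK (drsubmx A)) -{1}(vsubmxK (dsubmx d)) mul_block_col.
by rewrite -{1}(vsubmxK (dlsubmx A)) mul_col_mx add_col_mx col_mxKd addrA.
Qed.

Variables (b : block_data R c u s) (bb : block_bounds b).
Variables (A : 'M[R]_(c + (u + s))) (hA : in_imx (block_imx b) A).

Let hC : in_imx (mC b) (ulsubmx A).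
Proof.
move=> i j; have := hA (lshift _ i) (lshift _ j).
by rewrite block_mxEul !mxE.
Qed.
Let hec1 : in_imx (mec1 b) (lsubmx (ursubmx A)).
Proof.
move=> i j; have := hA (lshift _ i) (rshift _ (lshift _ j)).
by rewrite block_mxEur row_mxEl !mxE.
Qed.
Let hec2 : in_imx (mec2 b) (rsubmx (ursubmx A)).
Proof.
move=> i j; have := hA (lshift _ i) (rshift _ (rshift _ j)).
by rewrite block_mxEur row_mxEr !mxE.
Qed.
Let hem1 : in_imx (mem1 b) (usubmx (dlsubmx A)).
Proof.
move=> i j; have := hA (rshift _ (lshift _ i)) (lshift _ j).
by rewrite block_mxEdl col_mxEu !mxE.
Qed.
Let hem2 : in_imx (Defs.mem2 b) (dsubmx (dlsubmx A)).
Proof.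
move=> i j; have := hA (rshift _ (rshift _ i)) (lshift _ j).
by rewrite block_mxEdl col_mxEd !mxE.
Qed.
Let hAA : in_imx (mA b) (ulsubmx (drsubmx A)).
Proof.
move=> i j; have := hA (rshift _ (lshift _ i)) (rshift _ (lshift _ j)).
by rewrite block_mxEdr block_mxEul !mxE.
Qed.
Let heu : in_imx (meu b) (ursubmx (drsubmx A)).
Proof.
move=> i j; have := hA (rshift _ (lshift _ i)) (rshift _ (rshift _ j)).
by rewrite block_mxEdr block_mxEur !mxE.
Qed.
Let hes : in_imx (mes b) (dlsubmx (drsubmx A)).
Proof.
move=> i j; have := hA (rshift _ (rshift _ i)) (rshift _ (lshift _ j)).
by rewrite block_mxEdr block_mxEdl !mxE.
Qed.
Let hB : in_imx (mB b) (drsubmx (drsubmx A)).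
Proof.
move=> i j; have := hA (rshift _ (rshift _ i)) (rshift _ (rshift _ j)).
by rewrite block_mxEdr block_mxEdr !mxE.
Qed.

Lemma dot_mul_le m n (E : 'M[R]_(m, n)) e x y : eopnorm E < e ->
  dot x (E *m y) <= e * (enorm x * enorm y).
Proof.
move=> Ee; rewrite (le_trans (dot_enorm _ _))// mulrCA ler_wpM2l ?enorm_ge0//.
exact: eopnorm_lt.
Qed.

Lemma dot_mul_ge m n (E : 'M[R]_(m, n)) e x y : eopnorm E < e ->
  - (e * (enorm x * enorm y)) <= dot x (E *m y).
Proof. by move=> Ee; rewrite lerNl -dotNl -(enormN x) dot_mul_le. Qed.

(** In each component the diagonal block contributes its quadratic form and the
    other two blocks mixed terms bounded by their operator norms. *)
Lemma block_x d : delta_u b * enorm (pi_x d) ^+ 2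
    - eps_m b * (enorm (pi_x d) * enorm (pi_th d))
    - eps_u b * (enorm (pi_x d) * enorm (pi_y d))
  <= dot (pi_x d) (pi_x (A *m d)).
Proof.
rewrite pi_x_mul !dotDr enorm_sq.
have := qform_inf_lt (pi_x d) (bound_A bb hAA).
have := dot_mul_ge (pi_x d) (pi_th d) (bound_em1 bb hem1).
have := dot_mul_ge (pi_x d) (pi_y d) (bound_eu bb heu).
lra.
Qed.

Lemma block_y d : dot (pi_y d) (pi_y (A *m d)) <=
  - delta_s b * enorm (pi_y d) ^+ 2
    + eps_m b * (enorm (pi_y d) * enorm (pi_th d))
    + eps_s b * (enorm (pi_y d) * enorm (pi_x d)).
Proof.
rewrite pi_y_mul !dotDr enorm_sq.
have := qform_sup_lt (pi_y d) (bound_B bb hB).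
have := dot_mul_le (pi_y d) (pi_th d) (bound_em2 bb hem2).
have := dot_mul_le (pi_y d) (pi_x d) (bound_es bb hes).
lra.
Qed.

Lemma block_th_le d : dot (pi_th d) (pi_th (A *m d)) <=
  c_u b * enorm (pi_th d) ^+ 2
    + eps_c b * (enorm (pi_th d) * enorm (pi_x d))
    + eps_c b * (enorm (pi_th d) * enorm (pi_y d)).
Proof.
rewrite pi_th_mul !dotDr enorm_sq.
have := qform_sup_lt (pi_th d) (bound_C bb hC).2.
have := dot_mul_le (pi_th d) (pi_x d) (bound_ec1 bb hec1).
have := dot_mul_le (pi_th d) (pi_y d) (bound_ec2 bb hec2).
lra.
Qed.

Lemma block_th_ge d : c_s b * enorm (pi_th d) ^+ 2
    - eps_c b * (enorm (pi_th d) * enorm (pi_x d))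
    - eps_c b * (enorm (pi_th d) * enorm (pi_y d))
  <= dot (pi_th d) (pi_th (A *m d)).
Proof.
rewrite pi_th_mul !dotDr enorm_sq.
have := qform_inf_lt (pi_th d) (bound_C bb hC).1.
have := dot_mul_ge (pi_th d) (pi_x d) (bound_ec1 bb hec1).
have := dot_mul_ge (pi_th d) (pi_y d) (bound_ec2 bb hec2).
lra.
Qed.

End AlignedFrames.

(** Arithmetic-geometric mean inequality. The weight [w] is a coefficient of the
    cone form; this is how quotients such as [alpha / gamma] enter the rates. *)
Lemma mixed_term (R : realFieldType) (w e X Y : R) : 0 < w -> 0 < e ->
  w * (e * (X * Y)) <= 2^-1 * (w * e * X ^+ 2 + w * e * Y ^+ 2).
Proof.
move=> w0 e0; have := mulr_ge0 (mulr_ge0 (ltW w0) (ltW e0)) (sqr_ge0 (X - Y)).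
lra.
Qed.

(** * Cone conditions and isolation for the aligned field *)

Lemma enorm_segment (R : realType) n (x y a : 'cV[R]_n) rho (t : R) :
  enorm (x - a) <= rho -> enorm (y - a) <= rho -> 0 <= t <= 1 ->
  enorm (y + t *: (x - y) - a) <= rho.
Proof.
move=> xa ya /andP[t0 t1].
have -> : y + t *: (x - y) - a = (1 - t) *: (y - a) + t *: (x - a).
  by apply/colP => i; rewrite !mxE; ring.
rewrite (le_trans (enormD _ _))// !enormZ !ger0_norm ?subr_ge0//.
have t1' : 0 <= 1 - t by rewrite subr_ge0.
have := ler_wpM2l t0 xa; have := ler_wpM2l t1' ya; lra.
Qed.

Section AlignedField.
Variables (R : realType) (c u s : nat).
Variables (f : 'cV[R]_(c + (u + s)) -> 'cV[R]_(c + (u + s))).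
Variables (Rc r rho : R) (b : 'cV[R]_c -> block_data R c u s).
Implicit Types p q : 'cV[R]_(c + (u + s)).

Hypothesis (Rc0 : 0 < Rc) (r0 : 0 < r) (rho0 : 0 < rho).
Hypothesis df : forall p, Dphi Rc r p -> differentiable f p.
Hypothesis encl : forall th, cball 0 Rc th ->
  enclosure f (Nbox Rc r rho th) `<=` in_imx (block_imx (b th)).
Hypothesis bounds : forall th, cball 0 Rc th -> block_bounds (b th).

(** Both points lie over the ball of radius [rho] about [th], hence so does the
    segment that joins them. *)
Lemma mean_value_block th p q : enorm th <= Rc -> Dphi Rc r p -> Dphi Rc r q ->
  enorm (pi_th p - th) <= rho -> enorm (pi_th q - th) <= rho ->
  exists2 A, in_imx (block_imx (b th)) A & f p - f q = A *m (p - q).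
Proof.
move=> thR Dp Dq pth qth; have bth : cball 0 Rc th by rewrite /cball/= subr0.
have [||A [encA fA _]] := @mean_value_enclosure R _ f (Nbox Rc r rho th) p q.
- move=> t t01; case: Dp => p1 p2 p3; case: Dq => q1 q2 q3.
  have E : (pi_th (q + t *: (p - q)) = pi_th q + t *: (pi_th p - pi_th q)) *
     (pi_x (q + t *: (p - q)) = pi_x q + t *: (pi_x p - pi_x q)) *
     (pi_y (q + t *: (p - q)) = pi_y q + t *: (pi_y p - pi_y q)).
    by do !split; apply/colP => i; rewrite !mxE.
  by split; split; rewrite /cball/= E; apply: enorm_segment.
- by move=> x [_ /df].
- by exists A => //; exact: encl encA.
Qed.

(** Splitting the mixed terms of [block_x], [block_th_le] and [block_y] by
    [mixed_term] leaves exactly the three forward rates as coefficients of the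
    squared components. *)
Lemma forward_cone gamma a be : 0 < gamma -> 0 < a -> 0 < be ->
  r * Num.sqrt (a / gamma) < rho ->
  (forall th, cball 0 Rc th ->
     [/\ kappa_c_forw (b th) gamma a be < kappa_u_forw (b th) gamma a be,
         kappa_s_forw (b th) gamma a be < kappa_u_forw (b th) gamma a be
       & 0 < kappa_u_forw (b th) gamma a be]) ->
  exists2 m, 0 < m & forall p q,
    box (forward_frame R c u s) Rc r p -> box (forward_frame R c u s) Rc r q ->
    0 <= cone_form (forward_frame R c u s) a gamma be (p - q) (p - q) ->
    m * enorm (p - q) ^+ 2 <=
      cone_form (forward_frame R c u s) a gamma be (p - q) (f p - f q).
Proof.
move=> g0 a0 b0 rrho rates; apply: (uniform_cone a0 g0 b0 (ltW Rc0) (ltW r0) rrho).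
move=> th thR; have bth : cball 0 Rc th by rewrite /cball/= subr0.
have [k1 k2 k3] := rates th bth; have bb := bounds bth.
have [mu mu0 hmu] := cone_margin a0 g0 b0 k3 k1 k2.
exists mu => // p q bp bq; rewrite !fwdE => pth qth.
move: bp bq; rewrite !box_fwdE => Dp Dq.
have [A hA ->] := mean_value_block thR Dp Dq pth qth.
move: (p - q) => d; rewrite /cone_form !fwdE => Q0.
rewrite enorm_sq dot_split -!enorm_sq.
have := hmu (enorm (pi_x d) ^+ 2) (enorm (pi_th d) ^+ 2) (enorm (pi_y d) ^+ 2).
rewrite !sqr_ge0 !enorm_sq => /(_ isT isT isT Q0); rewrite -!enorm_sq => h.
apply: le_trans h _.
have hx := ler_wpM2l (ltW a0) (block_x bb hA d).
have hy := ler_wpM2l (ltW b0) (block_y bb hA d).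
have ht := ler_wpM2l (ltW g0) (block_th_le bb hA d).
move: (enorm (pi_x d)) (enorm (pi_th d)) (enorm (pi_y d)) hx ht hy => X T Y hx ht hy.
have [_ _ ec em eu es _ _ _ _ _ _ _ _ _] := bb.
have m1 := mixed_term X T a0 em; have m2 := mixed_term X Y a0 eu.
have m3 := mixed_term T X g0 ec; have m4 := mixed_term T Y g0 ec.
have m5 := mixed_term Y T b0 em; have m6 := mixed_term Y X b0 es.
have -> : kappa_c_forw (b th) gamma a be * (gamma * T ^+ 2) =
    c_u (b th) * (gamma * T ^+ 2) +
    2^-1 * (a * eps_m (b th) + be * eps_m (b th) + 2 * gamma * eps_c (b th)) * T ^+ 2.
  by rewrite /kappa_c_forw; field; rewrite gt_eqF.
have -> : kappa_u_forw (b th) gamma a be * (a * X ^+ 2) =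
    delta_u (b th) * (a * X ^+ 2) -
    2^-1 * (a * eps_m (b th) + a * eps_u (b th) + gamma * eps_c (b th) +
            be * eps_s (b th)) * X ^+ 2.
  by rewrite /kappa_u_forw; field; rewrite gt_eqF.
have -> : kappa_s_forw (b th) gamma a be * (be * Y ^+ 2) =
    - delta_s (b th) * (be * Y ^+ 2) +
    2^-1 * (be * eps_m (b th) + a * eps_u (b th) + gamma * eps_c (b th) +
            be * eps_s (b th)) * Y ^+ 2.
  by rewrite /kappa_s_forw; field; rewrite gt_eqF.
lra.
Qed.

(** For the reversed field the [y] block expands, with rate
    [- kappa_s_back], and the other two rates also change sign. *)
Lemma backward_cone gamma a be : 0 < gamma -> 0 < a -> 0 < be ->
  r * Num.sqrt (be / gamma) < rho ->
  (forall th, cball 0 Rc th ->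
     [/\ kappa_s_back (b th) gamma a be < 0,
         kappa_s_back (b th) gamma a be < kappa_c_back (b th) gamma a be
       & kappa_s_back (b th) gamma a be < kappa_u_back (b th) gamma a be]) ->
  exists2 m, 0 < m & forall p q,
    box (backward_frame R c u s) Rc r p -> box (backward_frame R c u s) Rc r q ->
    0 <= cone_form (backward_frame R c u s) be gamma a (p - q) (p - q) ->
    m * enorm (p - q) ^+ 2 <=
      cone_form (backward_frame R c u s) be gamma a (p - q) (- f p - - f q).
Proof.
move=> g0 a0 b0 rrho rates.
apply: (@uniform_cone _ _ _ _ _ _ _ _ _ _ _ rho (fun p => - f p)) => //; try exact: ltW.
move=> th thR; have bth : cball 0 Rc th by rewrite /cball/= subr0.
have [k1 k2 k3] := rates th bth; have bb := bounds bth.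
rewrite -oppr_gt0 in k1; rewrite -ltrN2 in k2; rewrite -ltrN2 in k3.
have [mu mu0 hmu] := cone_margin b0 g0 a0 k1 k2 k3.
exists mu => // p q bp bq; rewrite !bwdE => pth qth.
move: bp bq; rewrite !box_bwdE => Dp Dq.
rewrite -opprD; have [A hA ->] := mean_value_block thR Dp Dq pth qth.
move: (p - q) => d; rewrite -scaleN1r /cone_form !(ctZ, cxZ, cyZ) !bwdE => Q0.
rewrite enorm_sq dot_split -!enorm_sq !dotZr.
have := hmu (enorm (pi_y d) ^+ 2) (enorm (pi_th d) ^+ 2) (enorm (pi_x d) ^+ 2).
rewrite !sqr_ge0 !enorm_sq => /(_ isT isT isT Q0); rewrite -!enorm_sq => h.
rewrite addrAC; apply: le_trans h _.
have hx := ler_wpM2l (ltW a0) (block_x bb hA d).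
have hy := ler_wpM2l (ltW b0) (block_y bb hA d).
have ht := ler_wpM2l (ltW g0) (block_th_ge bb hA d).
move: (enorm (pi_x d)) (enorm (pi_th d)) (enorm (pi_y d)) hx ht hy => X T Y hx ht hy.
have [_ _ ec em eu es _ _ _ _ _ _ _ _ _] := bb.
have m1 := mixed_term X T a0 em; have m2 := mixed_term X Y a0 eu.
have m3 := mixed_term T X g0 ec; have m4 := mixed_term T Y g0 ec.
have m5 := mixed_term Y T b0 em; have m6 := mixed_term Y X b0 es.
have E1 : kappa_c_back (b th) gamma a be * (gamma * T ^+ 2) =
    c_s (b th) * (gamma * T ^+ 2) -
    2^-1 * (a * eps_m (b th) + be * eps_m (b th) + 2 * gamma * eps_c (b th)) * T ^+ 2.
  by rewrite /kappa_c_back; field; rewrite gt_eqF.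
have E2 : kappa_u_back (b th) gamma a be * (a * X ^+ 2) =
    delta_u (b th) * (a * X ^+ 2) -
    2^-1 * (a * eps_m (b th) + a * eps_u (b th) + gamma * eps_c (b th) +
            be * eps_s (b th)) * X ^+ 2.
  by rewrite /kappa_u_back; field; rewrite gt_eqF.
have E3 : kappa_s_back (b th) gamma a be * (be * Y ^+ 2) =
    - delta_s (b th) * (be * Y ^+ 2) +
    2^-1 * (be * eps_m (b th) + a * eps_u (b th) + gamma * eps_c (b th) +
            be * eps_s (b th)) * Y ^+ 2.
  by rewrite /kappa_s_back; field; rewrite gt_eqF.
rewrite !mulNr E1 E2 E3; lra.
Qed.

Hypothesis isolation : forall th, cball 0 Rc th ->
  exists Eu Es : R,
    [/\ 0 < Eu, 0 < Es,
        (forall q, (Nbox Rc r rho th `&` prod3 (cball 0 Rc) [set 0] [set 0]) q ->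
           enorm (pi_x (f q)) < r * Eu /\ enorm (pi_y (f q)) < r * Es),
        Eu + eps_u (b th) < delta_u (b th)
      & Es + eps_s (b th) < delta_s (b th)].

(** The field on a face is compared with its value at the point of the disc
    [x = y = 0] over the same [th]. *)
Lemma face_compare p : Dphi Rc r p ->
  exists q A, [/\ in_imx (block_imx (b (pi_th p))) A, f p = f q + A *m (p - q),
    pi_th (p - q) = 0, pi_x (p - q) = pi_x p /\ pi_y (p - q) = pi_y p
  & exists Eu Es, [/\ enorm (pi_x (f q)) < r * Eu, enorm (pi_y (f q)) < r * Es,
    Eu + eps_u (b (pi_th p)) < delta_u (b (pi_th p))
    & Es + eps_s (b (pi_th p)) < delta_s (b (pi_th p))]].
Proof.
move=> Dp; have [p1 p2 p3] := Dp; rewrite /cball/= in p1 p2 p3.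
pose q : 'cV[R]_(c + (u + s)) := join3 (pi_th p) 0 0.
have p1' : enorm (pi_th p) <= Rc by rewrite -(subr0 (pi_th p)).
have Dq : Dphi Rc r q.
  split; rewrite /cball/= subr0 ?pi_th_join ?pi_x_join ?pi_y_join ?enorm0//;
  exact: ltW.
have [||A hA fA] := mean_value_block p1' Dp Dq.
- by rewrite subrr enorm0 ltW.
- by rewrite pi_th_join subrr enorm0 ltW.
exists q, A; split=> //.
- by rewrite -fA addrC subrK.
- have -> : pi_th (p - q) = pi_th p - pi_th q by apply/colP => i; rewrite !mxE.
  by rewrite pi_th_join subrr.
- have -> : pi_x (p - q) = pi_x p - pi_x q by apply/colP => i; rewrite !mxE.
  have -> : pi_y (p - q) = pi_y p - pi_y q by apply/colP => i; rewrite !mxE.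
  by rewrite pi_x_join pi_y_join !subr0.
have [Eu [Es [_ _ hq h1 h2]]] := isolation p1; exists Eu, Es.
have [|? ?] := hq q; last by split.
have [q1 q2 q3] := Dq.
split; last by split => //=; [exact: pi_x_join|exact: pi_y_join].
by split=> //; split=> //; rewrite /cball/= pi_th_join subrr enorm0 ltW.
Qed.

(** On the face [|x| = r] the block [mA] pushes outwards by more than
    [delta_u * r]; against it stand at most [r * Eu] from the field on the disc
    and [eps_u * r] from the [y] component. *)
Lemma face_out p : Dphi Rc r p -> enorm (pi_x p) = r ->
  0 < dot (pi_x p) (pi_x (f p)).
Proof.
move=> Dp pr; have [q [A [hA -> dt [dx dy] [Eu [Es [hu _ hd _]]]]]] := face_compare Dp.
have [bth _ _] := Dp.
have bb := bounds bth.
have := block_x bb hA (p - q); rewrite dt dx dy enorm0 mulr0 mulr0 subr0 pr.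
have -> : pi_x (f q + A *m (p - q)) = pi_x (f q) + pi_x (A *m (p - q)).
  by apply/colP => i; rewrite !mxE.
rewrite dotDr; have := dot_enormN (pi_x p) (pi_x (f q)); rewrite pr.
have yr : enorm (pi_y p) <= r by case: Dp => _ _; rewrite /cball/= subr0.
have := ler_wpM2l (ltW (mulr_gt0 (eps_u_gt0 bb) r0)) yr.
move: hu; rewrite -(ltr_pM2l r0) => hu.
move: hd; rewrite -(ltr_pM2l (mulr_gt0 r0 r0)); lra.
Qed.

Lemma face_in p : Dphi Rc r p -> enorm (pi_y p) = r ->
  dot (pi_y p) (pi_y (f p)) < 0.
Proof.
move=> Dp pr; have [q [A [hA -> dt [dx dy] [Eu [Es [_ hu _ hd]]]]]] := face_compare Dp.
have [bth _ _] := Dp.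
have bb := bounds bth.
have := block_y bb hA (p - q); rewrite dt dx dy enorm0 mulr0 mulr0 addr0 pr.
have -> : pi_y (f q + A *m (p - q)) = pi_y (f q) + pi_y (A *m (p - q)).
  by apply/colP => i; rewrite !mxE.
rewrite dotDr; have := dot_enorm (pi_y p) (pi_y (f q)); rewrite pr.
have yr : enorm (pi_x p) <= r by case: Dp => _; rewrite /cball/= subr0.
have := ler_wpM2l (ltW (mulr_gt0 (eps_s_gt0 bb) r0)) yr.
move: hu; rewrite -(ltr_pM2l r0) => hu.
move: hd; rewrite -(ltr_pM2l (mulr_gt0 r0 r0)); lra.
Qed.

End AlignedField.

(** * The flow in aligned coordinates *)

Lemma is_derive_near_eq (R : realType) n (q q' : R -> 'cV[R]_n) (t d : R) v :
  0 < d -> (forall s, `|s - t| < d -> q s = q' s) ->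
  is_derive t (1 : R) q v -> is_derive t (1 : R) q' v.
Proof.
move=> d0 qq'; apply: near_eq_is_derive; apply/nbhs_ballP; exists d => // x.
by rewrite -ball_normE /ball_/= distrC => /qq'.
Qed.

Lemma is_derive_shift_time (R : realType) n (q : R -> 'cV[R]_n) (T t : R) v :
  is_derive (t - T) (1 : R) q v -> is_derive t (1 : R) (fun s => q (s - T)) v.
Proof.
move=> /is_derive_enormP H; apply/is_derive_enormP => e /H[d d0 hd].
exists d => // x xd; have := hd (x - T).
by rewrite (_ : x - T - (t - T) = x - t); [exact|ring].
Qed.

Lemma is_derive_opp_time (R : realType) n (q : R -> 'cV[R]_n) (t : R) v :
  is_derive (- t) (1 : R) q v -> is_derive t (1 : R) (fun s => q (- s)) (- v).
Proof.
move=> /is_derive_enormP H; apply/is_derive_enormP => e e0.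
have [d d0 hd] := H e e0; exists d => // x xd.
have := hd (- x); rewrite (_ : - x - - t = - (x - t)); last by ring.
by rewrite normrN scaleNr -scalerN; exact.
Qed.

Lemma is_flow_rev (R : realType) n (F : 'cV[R]_n -> 'cV[R]_n) dom Phi :
  is_flow F dom Phi ->
  is_flow (fun x => - F x) (fun x => [set t | dom x (- t)]) (fun t x => Phi (- t) x).
Proof.
move=> fl x; have [[odom idom d0 P0 sol] uniq] := fl x.
have opN (J : set R) : open J -> open [set t | J (- t)].
  by move=> oJ; apply: (@open_comp _ _ -%R) => // t _; exact: oppr_continuous.
have itN (J : set R) : is_interval J -> is_interval [set t | J (- t)].
  move=> iJ a b /= Ja Jb t /andP[ta tb]; apply: (iJ _ _ Jb Ja).
  by rewrite !lerN2 ta tb.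
split; first split.
- exact: opN.
- exact: itN.
- by rewrite /= oppr0.
- by rewrite oppr0.
- by move=> t /= /sol; exact: is_derive_opp_time.
move=> J g oJ iJ J0 g0 gsol.
have [|||||dJ gJ] := uniq [set t | J (- t)] (fun t => g (- t)).
- exact: opN.
- exact: itN.
- by rewrite /= oppr0.
- by rewrite oppr0.
- by move=> t /= /gsol /is_derive_opp_time; rewrite opprK.
by split=> t Jt; [apply: dJ|rewrite -gJ]; rewrite /= opprK.
Qed.

Section Flow.
Variables (R : realType) (c u s : nat).
Local Notation E := 'cV[R]_(c + (u + s)).
Variables (G : E -> E) (dom : E -> set R) (Phi : R -> E -> E) (U D : set E).
Variables (phi psi : E -> E) (Rc r L M : R).
Local Notation f := (aligned_field phi psi G).
Hypothesis fl : is_flow G dom Phi.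
Hypothesis dif : diffeo_on U phi psi.
Hypothesis DU : D `<=` U.
Hypothesis phiD : phi @` D = Dphi Rc r.
Hypotheses (L0 : 0 < L) (M0 : 0 < M).
Hypothesis f_lip : forall p q, Dphi Rc r p -> Dphi Rc r q ->
  enorm (f p - f q) <= L * enorm (p - q).
Hypothesis f_bnd : forall p, Dphi Rc r p -> enorm (f p) <= M.

Lemma psiK x : U x -> psi (phi x) = x.
Proof. by case: dif => _ _ + _ _; apply. Qed.

Lemma psi_D p : Dphi Rc r p -> D (psi p) /\ phi (psi p) = p.
Proof. by rewrite -phiD => -[x Dx <-]; rewrite psiK//; exact: DU. Qed.

Lemma Dphi_phi x : D x -> Dphi Rc r (phi x).
Proof. by rewrite -phiD => Dx; exists x. Qed.

Lemma phi_D x : U x -> Dphi Rc r (phi x) -> D x.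
Proof. by move=> Ux /psi_D[+ _]; rewrite psiK. Qed.

Lemma aligned_ode x (t : R) : dom x t -> U (Phi t x) ->
  is_derive t (1 : R) (fun s => phi (Phi s x)) (f (phi (Phi t x))).
Proof.
move=> dt Ut; have [[_ _ _ _ sol] _] := fl x.
rewrite /aligned_field psiK//; apply: is_derive_diff_comp; first exact: sol.
by case: dif => _ _ _ /(_ _ Ut)[].
Qed.

Lemma dom_nbhs x (t : R) : dom x t ->
  exists2 e, 0 < e & forall s : R, `|s - t| < e -> dom x s.
Proof.
move=> dt; have [[od _ _ _ _] _] := fl x.
have /nbhs_ballP[e /= e0 he] := open_nbhs_nbhs (conj od dt).
by exists e => // t' t't; apply: he; rewrite -ball_normE /ball_/= distrC.
Qed.

Lemma U_nbhs x (t : R) : dom x t -> U (Phi t x) ->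
  exists2 e, 0 < e & forall s : R, `|s - t| < e -> dom x s /\ U (Phi s x).
Proof.
move=> dt Ut; have [e1 e10 h1] := dom_nbhs dt.
have [oU _ _ _ _] := dif.
have /nbhs_enormP[e e0 he] := open_nbhs_nbhs (conj oU Ut).
have [[_ _ _ _ sol] _] := fl x.
have [e2 e20 h2] := is_derive_near (sol t dt) e0.
exists (Num.min e1 e2); first by rewrite lt_min e10.
by move=> t'; rewrite lt_min => /andP[/h1 ? /h2 ?]; split=> //; exact: he.
Qed.

(** In aligned coordinates the confined orbit is Lipschitz, so it converges as
    [t] tends to [T], with a one-sided derivative at the limit [l]. *)
Lemma orbit_left_limit x T : 0 < T ->
  (forall t, 0 <= t < T -> dom x t /\ D (Phi t x)) ->
  exists2 l, Dphi Rc r l & forall t, 0 <= t < T ->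
    enorm (phi (Phi t x) - l) <= M * (T - t) /\
    enorm (phi (Phi t x) - l - (t - T) *: f l) <= L * M * (T - t) ^+ 2.
Proof.
move=> T0 St; pose q t := phi (Phi t x).
have qD t : 0 <= t < T -> Dphi Rc r (q t) by move=> /St[_ /Dphi_phi].
have dq (t : R) : 0 <= t < T -> is_derive t (1 : R) q (f (q t)).
  by move=> /St[dt Dt]; apply: aligned_ode => //; exact: DU.
have qlip t t' : 0 <= t -> t <= t' -> t' < T ->
    enorm (q t' - q t) <= M * (t' - t).
  move=> t0 tt' t'T.
  have := @mean_value_ineq R _ q (f \o q) t t' 0 M tt'.
  rewrite scaler0 subr0; apply=> w wt; first by apply: dq; lra.
  by rewrite subr0; apply/f_bnd/qD; lra.
pose w (k : nat) := T - T / k.+1%:R.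
have w0T k : 0 <= w k < T.
  rewrite /w ltrBlDr ltrDl divr_gt0// andbT subr_ge0 ler_pdivrMr//.
  by rewrite ler_peMr ?ler1n// ltW.
have qb k : enorm (q (w k)) <= Rc + r + r.
  have [] := qD (w k) (w0T k); rewrite /cball/= !subr0 => h1 h2 h3.
  rewrite enorm_le; last first.
    by have := enorm_ge0 (pi_th (q (w k))); have := enorm_ge0 (pi_x (q (w k)));
      have := enorm_ge0 (pi_y (q (w k))); lra.
  rewrite dot_split -!enorm_sq; move: h1 h2 h3.
  move: (enorm_ge0 (pi_th (q (w k)))) (enorm_ge0 (pi_x (q (w k)))).
  move: (enorm_ge0 (pi_y (q (w k)))).
  move: (enorm (pi_th _)) (enorm (pi_x _)) (enorm (pi_y _)) => A B C; nra.
have [l _ cl] := enorm_cluster qb.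
have ql t : 0 <= t < T -> enorm (q t - l) <= M * (T - t).
  move=> /andP[t0 tT]; apply/ler_addgt0Pr => e e0.
  have [k kN kl] := cl e (Num.truncn (T / (T - t))) e0.
  have tw : t <= w k.
    rewrite /w lerBrDr addrC -lerBrDr ler_pdivrMr// mulrC -ler_pdivrMr ?subr_gt0//.
    by rewrite (le_trans (ltW (truncnS_gt _)))// ler_nat.
  have /andP[w0 wT] := w0T k.
  have := qlip t (w k) t0 tw wT; rewrite enormB => h.
  have := enormDB (q (w k)) (q t) l.
  have : M * (w k - t) <= M * (T - t) by rewrite ler_pM2l//; lra.
  lra.
have lD : Dphi Rc r l.
  have lim (p : E -> R) rr : (forall a b, p a <= p b + enorm (a - b)) ->
      (forall a, Dphi Rc r a -> p a <= rr) -> p l <= rr.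
    move=> pl pr; apply/ler_addgt0Pr => e e0.
    have [k _ kl] := cl e 0%N e0.
    have := pl l (q (w k)); have := pr _ (qD _ (w0T k)); rewrite enormB; lra.
  split; rewrite /cball/= subr0.
  - apply: (lim (fun a => enorm (pi_th a))) => [a b|a [a1 a2 a3]].
      have := enormD (pi_th b) (pi_th (a - b)).
      have -> : pi_th b + pi_th (a - b) = pi_th a.
        by apply/colP => i; rewrite !mxE; ring.
      by have := ct_le (forward_frame R c u s) (a - b); rewrite fwdE; lra.
    by move: a1; rewrite /cball/= subr0.
  - apply: (lim (fun a => enorm (pi_x a))) => [a b|a [a1 a2 a3]].
      have := enormD (pi_x b) (pi_x (a - b)).
      have -> : pi_x b + pi_x (a - b) = pi_x a.
        by apply/colP => i; rewrite !mxE; ring.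
      by have := cx_le (forward_frame R c u s) (a - b); rewrite fwdE; lra.
    by move: a2; rewrite /cball/= subr0.
  - apply: (lim (fun a => enorm (pi_y a))) => [a b|a [a1 a2 a3]].
      have := enormD (pi_y b) (pi_y (a - b)).
      have -> : pi_y b + pi_y (a - b) = pi_y a.
        by apply/colP => i; rewrite !mxE; ring.
      by have := cy_le (forward_frame R c u s) (a - b); rewrite fwdE; lra.
    by move: a3; rewrite /cball/= subr0.
exists l => // t tT; split; first exact: ql.
apply/ler_addgt0Pr => e e0; have /andP[t0 tT'] := tT.
pose d := Num.min (T - t) (e / (2 * M)).
have d0 : 0 < d by rewrite lt_min subr_gt0 tT' divr_gt0// mulr_gt0.
have dT : d <= T - t by rewrite ge_min lexx.
have dM : d * (2 * M) <= e by rewrite -ler_pdivlMr ?mulr_gt0// ge_min lexx orbT.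
pose t' := T - d.
have h1 := ql t' ltac:(rewrite /t'; lra).
have tt' : t <= t' by rewrite /t'; lra.
have h : enorm (q t' - q t - (t' - t) *: f l) <= L * (M * (T - t)) * (t' - t).
  apply: (@mean_value_ineq R _ q (f \o q)) => // a at'.
    by apply: dq; rewrite /t' in at'; lra.
  have aT : 0 <= a < T by rewrite /t' in at'; lra.
  apply: le_trans (f_lip (qD a aT) lD) _; rewrite ler_pM2l//.
  by apply: le_trans (ql a aT) _; rewrite ler_pM2l//; lra.
have -> : phi (Phi t x) - l - (t - T) *: f l =
   - (q t' - q t - (t' - t) *: f l) + ((q t' - l) + (T - t') *: f l).
  by rewrite /q; apply/colP => i; rewrite !mxE; ring.
apply: le_trans (enormD _ _) _; rewrite enormN.
have := enormD (q t' - l) ((T - t') *: f l).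
rewrite enormZ ger0_norm; last by rewrite /t'; lra.
have := ler_wpM2l (ltac:(rewrite /t'; lra) : 0 <= T - t') (f_bnd lD).
have : L * (M * (T - t)) * (t' - t) <= L * M * (T - t) ^+ 2.
  rewrite expr2 !mulrA ler_wpM2l ?mulr_ge0 ?subr_ge0 ?ltW//.
  by rewrite /t'; lra.
move: h h1; rewrite /t'; lra.
Qed.

(** A solution confined to the compact set [D] on [[0, T)] is continued past
    [T] by the solution through its limit point. The two pieces are glued in
    aligned coordinates, where both one-sided derivatives equal [f l]. *)
Lemma confined_continuation x T : 0 < T ->
  (forall t, 0 <= t < T -> dom x t /\ D (Phi t x)) ->
  dom x T /\ D (Phi T x).
Proof.
move=> T0 St; have [l lD hl] := orbit_left_limit T0 St.
have [Dl phil] := psi_D lD; set xl := psi l in Dl phil.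
have Ul := DU Dl.
have [[_ _ d0 P0 soll] _] := fl xl; have [[_ _ dx0 Px0 solx] uniq] := fl x.
have Ul0 : U (Phi 0 xl) by rewrite P0.
have [e1 e10 h1] := U_nbhs d0 Ul0; have [e2 e20 h2] := dom_nbhs dx0.
pose g t := if t < T then Phi t x else Phi (t - T) xl.
have gT : g T = xl by rewrite /g ltxx subrr P0.
have dpsi : differentiable psi l.
  by case: dif => _ _ _ _ /(_ l)[]//; exists xl.
have dz : is_derive (0 : R) (1 : R) (fun s => phi (Phi s xl)) (f l).
  by have := aligned_ode d0 Ul0; rewrite P0 phil.
have dw : is_derive T (1 : R) (phi \o g) (f l).
  apply/is_derive_enormP => e e0; have /is_derive_enormP/(_ e e0)[d dd0 hd] := dz.
  have LM : 0 < L * M by rewrite mulr_gt0.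
  exists (Num.min d (Num.min T (e / (L * M)))).
    by rewrite !lt_min dd0 T0 divr_gt0.
  move=> t; rewrite !lt_min => /and3P[td tT]; rewrite ltr_pdivlMr// => te /=.
  rewrite gT phil /g; case: ltP => tT'; last first.
    have := hd (t - T); rewrite subr0 P0 phil; exact.
  move: tT te; rewrite ltr0_norm ?subr_lt0// => tT te.
  have [_] := hl t ltac:(lra); move=> /le_trans; apply.
  by rewrite opprB expr2 mulrA ler_wpM2r ?subr_ge0 ?ltW//; lra.
have Ug t : `|t - T| < Num.min T e1 -> U (g t).
  rewrite lt_min => /andP[tT te]; rewrite /g; case: ltP => tT'.
    by move: tT; rewrite ltr0_norm ?subr_lt0// => tT; apply/DU/(St t ltac:(lra)).2.
  by apply: (h1 _ _).2; rewrite subr0.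
have dgT : is_derive T (1 : R) g ('d psi l (f l)).
  apply: (@is_derive_near_eq _ _ (psi \o (phi \o g)) _ _ (Num.min T e1)).
  - by rewrite lt_min T0.
  - by move=> t /Ug Ut; rewrite /= psiK.
  - have := @is_derive_diff_comp _ _ _ (phi \o g) psi T _ dw.
    by rewrite /= gT phil; apply.
have GE : G xl = 'd psi l (f l).
  have : is_derive (0 : R) (1 : R) (Phi^~ xl) ('d psi l (f l)).
    apply: (@is_derive_near_eq _ _ (psi \o (fun s => phi (Phi s xl))) _ _ e1) => //.
    - by move=> t /h1[_ Ut]; rewrite /= psiK.
    - have := @is_derive_diff_comp _ _ _ (fun s => phi (Phi s xl)) psi 0 _ dz.
      by rewrite P0 phil; apply.
  have := soll 0 d0; rewrite P0 => -[_ <-] [_ <-] //.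
have [||||| JD gE] := uniq [set` `] - e2, T + e1[] g.
- exact: interval_open.
- exact: interval_is_interval.
- by rewrite /= in_itv/= oppr_lt0 e20 addr_gt0.
- by rewrite /g T0.
- move=> t /=; rewrite in_itv/= => /andP[t1 t2].
  have [tT|tT|->] := ltgtP t T; last by rewrite gT GE.
    have dt : dom x t.
      have [t0|t0] := ltP t 0; last by apply: (St t _).1; rewrite t0.
      by apply: h2; rewrite subr0 ltr0_norm//; lra.
    rewrite {2}/g tT; apply: (@is_derive_near_eq _ _ (Phi^~ x) _ _ (T - t)).
    + by rewrite subr_gt0.
    + move=> t'; rewrite /g => /(le_lt_trans (ler_norm _)) h.
      by rewrite ifT//; lra.
    + exact: solx.
  rewrite {2}/g ltNge (ltW tT)/=.
  apply: (@is_derive_near_eq _ _ (fun s => Phi (s - T) xl) _ _ (t - T)).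
  + by rewrite subr_gt0.
  + move=> t'; rewrite /g distrC => /(le_lt_trans (ler_norm _)) h.
    by rewrite ifF//; apply/negbTE; rewrite -leNgt; lra.
  + apply: (@is_derive_shift_time _ _ (Phi^~ xl)); apply: soll; apply: (h1 _ _).1.
    by rewrite subr0 gtr0_norm ?subr_gt0//; lra.
have JT : [set` `] - e2, T + e1[] T by rewrite /= in_itv/=; lra.
by split; [exact: JD|rewrite -(gE T JT) gT].
Qed.

Lemma flow_tracked u' s' (Fr : frame R (c + (u + s)) c u' s') p :
  box Fr Rc r = Dphi Rc r -> Dphi Rc r p ->
  (forall t, dom (psi p) t -> D (Phi t (psi p)) ->
     enorm (ct Fr (phi (Phi t (psi p)))) < Rc) ->
  tracked Fr Rc r f p (fun t => phi (Phi t (psi p)))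
    (fun t => dom (psi p) t /\ D (Phi t (psi p))).
Proof.
move=> boxE Dp side; have [Dx phix] := psi_D Dp.
have [[_ _ d0 P0 _] _] := fl (psi p).
split; rewrite ?P0 ?boxE//.
- by move=> t [dt Dt]; split; [exact: Dphi_phi|apply: aligned_ode => //; exact: DU].
- by move=> t t0; exact: confined_continuation.
- move=> t _ [dt Dt]; have [e e0 he] := U_nbhs dt (DU Dt).
  exists e => // t' tt' Dt'; have [|dt' Ut'] := he t'.
    by rewrite gtr0_norm; lra.
  by split=> //; exact: phi_D.
- by move=> t _ [dt Dt]; exact: side.
Qed.

Definition stays_forward p :=
  forall t : R, 0 <= t -> dom (psi p) t /\ D (Phi t (psi p)).

Section Direction.
Variables (u' s' : nat) (Fr : frame R (c + (u + s)) c u' s') (a g b m : R).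
Hypothesis boxE : box Fr Rc r = Dphi Rc r.
Hypotheses (a0 : 0 < a) (g0 : 0 < g) (b0 : 0 < b) (m0 : 0 < m).
Hypotheses (Rc0 : 0 <= Rc) (r0 : 0 < r).
Hypothesis f_cone : forall p q, box Fr Rc r p -> box Fr Rc r q ->
  0 <= cone_form Fr a g b (p - q) (p - q) ->
  m * enorm (p - q) ^+ 2 <= cone_form Fr a g b (p - q) (f p - f q).
Hypothesis f_out : forall p, box Fr Rc r p -> enorm (cx Fr p) = r ->
  0 < dot (cx Fr p) (cx Fr (f p)).
Hypothesis f_in : forall p, box Fr Rc r p -> enorm (cy Fr p) = r ->
  dot (cy Fr p) (cy Fr (f p)) < 0.

(** This and [stays_forward_cone] say that the points that stay in [D] in
    forward time form the graph of a function of [(th, y)], Lipschitz with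
    constants read off the cone. *)
Lemma stays_forward_exists th y : enorm th <= Rc -> enorm y <= r ->
  (forall x t, enorm x <= r -> dom (psi (join Fr th x y)) t ->
     D (Phi t (psi (join Fr th x y))) ->
     enorm (ct Fr (phi (Phi t (psi (join Fr th x y))))) < Rc) ->
  exists2 x, enorm x <= r & stays_forward (join Fr th x y).
Proof.
move=> thR yr side.
have f_lip' p q : box Fr Rc r p -> box Fr Rc r q ->
  enorm (f p - f q) <= L * enorm (p - q) by rewrite boxE; exact: f_lip.
have f_bnd' p : box Fr Rc r p -> enorm (f p) <= M by rewrite boxE; exact: f_bnd.
apply: (trapped_orbit Rc0 r0 L0 M0 f_lip' f_bnd' f_out f_in a0 g0 b0 m0
  f_cone thR yr) => x xr.
apply: flow_tracked => //; last by move=> t; exact: side.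
by rewrite -boxE; split; rewrite joinE.
Qed.

(** Two such points with a positive cone form would be separated by their
    orbits. *)
Lemma stays_forward_cone p q : Dphi Rc r p -> Dphi Rc r q ->
  stays_forward p -> stays_forward q ->
  cone_form Fr a g b (p - q) (p - q) <= 0.
Proof.
move=> Dp Dq sp sq.
rewrite leNgt; apply/negP => pq; have pq' := ltW pq.
have path z (t : R) : stays_forward z -> 0 <= t -> box Fr Rc r (phi (Phi t (psi z))) /\
    is_derive t (1 : R) (fun t => phi (Phi t (psi z))) (f (phi (Phi t (psi z)))).
  move=> sz t0; have [dt Dt] := sz t t0.
  by rewrite boxE; split; [exact: Dphi_phi|apply: aligned_ode => //; exact: DU].
have start z : Dphi Rc r z -> phi (Phi 0 (psi z)) = z.
  by move=> /psi_D[_ E]; have [[_ _ _ -> _] _] := fl (psi z).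
have := cone_separation a0 g0 b0 m0 f_cone (fun t => path p t sp)
  (fun t => path q t sq).
rewrite !start// => /(_ pq') pqE.
move: pq; rewrite pqE subrr /cone_form /ct /cx /cy.
by rewrite !linear0 !dot0l !mulr0 !subr0 ltxx.
Qed.

End Direction.

End Flow.

(** * Intersection of the two graphs *)

Lemma boundary_cball (R : realType) n (x : 'cV[R]_n) (r : R) :
  0 < r -> enorm x = r -> boundary (cball 0 r) x.
Proof.
move=> r0 xr; split; first by apply: subset_closure; rewrite /cball/= subr0 xr.
move=> /nbhs_enormP[e e0 he]; pose k := 1 + e / (2 * r).
have ek : 0 < e / (2 * r) by rewrite divr_gt0// mulr_gt0.
have := he (k *: x); rewrite (_ : k *: x - x = (k - 1) *: x); last first.
  by rewrite scalerBl scale1r.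
have -> : k - 1 = e / (2 * r) by rewrite /k addrC addKr.
rewrite enormZ gtr0_norm// xr /cball/= subr0 enormZ gtr0_norm; last first.
  by rewrite addr_gt0.
have -> : e / (2 * r) * r = e / 2 by field; rewrite gt_eqF.
move=> /(_ ltac:(lra)); rewrite xr leNgt => /negP; apply.
by rewrite ltr_pMl// /k ltrDl.
Qed.

Section Graphs.
Variables (R : realType) (c u s : nat) (g ah av bh bv r : R).
Variables Wf Wb : set 'cV[R]_(c + (u + s)).
Hypotheses (r0 : 0 < r) (g0 : 0 < g) (av0 : 0 < av) (bh0 : 0 < bh).
Hypotheses (avh : av < ah) (bhv : bh < bv).
Hypothesis Wf_lip : forall p q, Wf p -> Wf q ->
  ah * enorm (pi_x (p - q)) ^+ 2 <=
    g * enorm (pi_th (p - q)) ^+ 2 + bh * enorm (pi_y (p - q)) ^+ 2.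
Hypothesis Wb_lip : forall p q, Wb p -> Wb q ->
  bv * enorm (pi_y (p - q)) ^+ 2 <=
    g * enorm (pi_th (p - q)) ^+ 2 + av * enorm (pi_x (p - q)) ^+ 2.

(** Over a fixed [th] the two graphs have Lipschitz constants
    [sqrt (bh / ah)] and [sqrt (av / bv)], whose product is less than one. *)
Lemma graphs_meet th :
  (forall y, enorm y <= r -> exists2 x, enorm x <= r & Wf (join3 th x y)) ->
  (forall x, enorm x <= r -> exists2 y, enorm y <= r & Wb (join3 th x y)) ->
  exists x y, [/\ enorm x <= r, enorm y <= r, Wf (join3 th x y)
    & Wb (join3 th x y)].
Proof.
move=> Hf Hb; have ah0 := lt_trans av0 avh; have bv0 := lt_trans bh0 bhv.
have /choice[wf wfP] : forall y : 'cV[R]_s, exists x, enorm y <= r ->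
    enorm x <= r /\ Wf (join3 th x y).
  move=> y; have [yr|] := boolP (enorm y <= r); last by exists 0.
  by have [x ? ?] := Hf y yr; exists x.
have /choice[wb wbP] : forall x : 'cV[R]_u, exists y, enorm x <= r ->
    enorm y <= r /\ Wb (join3 th x y).
  move=> x; have [xr|] := boolP (enorm x <= r); last by exists 0.
  by have [y ? ?] := Hb x xr; exists y.
have diff (x : 'cV[R]_u) (y : 'cV[R]_s) (x' : 'cV[R]_u) (y' : 'cV[R]_s) :
    (pi_th (join3 th x y - join3 th x' y') = 0) *
    (pi_x (join3 th x y - join3 th x' y') = x - x') *
    (pi_y (join3 th x y - join3 th x' y') = y - y').
  have := (pi_th_join th x y, pi_th_join th x' y', pi_x_join th x y,
    pi_x_join th x' y', pi_y_join th x y, pi_y_join th x' y').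
  set p := join3 th x y; set q := join3 th x' y' => e.
  have -> : pi_th (p - q) = pi_th p - pi_th q by apply/colP => i; rewrite !mxE.
  have -> : pi_x (p - q) = pi_x p - pi_x q by apply/colP => i; rewrite !mxE.
  have -> : pi_y (p - q) = pi_y p - pi_y q by apply/colP => i; rewrite !mxE.
  by rewrite !e subrr.
pose k := bh * av / (ah * bv).
have k0 : 0 <= k by rewrite divr_ge0// mulr_ge0// ltW.
have k1 : k < 1.
  by rewrite ltr_pdivrMr ?mulr_gt0// mul1r mulrC ltr_pM// ltW.
have [|||x xr fx] := @contraction_fixpoint R u r (wf \o wb) (Num.sqrt k) (ltW r0).
- rewrite sqrtr_ge0/= -[ltRHS]sqrtr1 ltr_sqrt//.
- by move=> x xr; have [yr _] := wbP x xr; have [] := wfP _ yr.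
- move=> x x' xr x'r /=.
  have [yr bx] := wbP x xr; have [y'r bx'] := wbP x' x'r.
  have [_ fy] := wfP _ yr; have [_ fy'] := wfP _ y'r.
  have := Wb_lip bx bx'; rewrite !diff enorm0 expr0n mulr0 add0r => h1.
  have := Wf_lip fy fy'; rewrite !diff enorm0 expr0n mulr0 add0r => h2.
  rewrite -ler_sqr ?nnegrE ?mulr_ge0 ?enorm_ge0 ?sqrtr_ge0// exprMn.
  rewrite [Num.sqrt k ^+ 2]sqr_sqrtr//.
  rewrite /k [leRHS]mulrAC ler_pdivlMr ?mulr_gt0//.
  have := ler_wpM2l (ltW bv0) h2; have := ler_wpM2l (ltW bh0) h1; lra.
have [yr bx] := wbP x xr; have [_ fy] := wfP _ yr.
by exists x, (wb x); split=> //; rewrite -[X in join3 th X _]fx.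
Qed.

(** In the sum of the two cone inequalities the [x] and [y] terms of the right
    side are absorbed by the left one. *)
Lemma graphs_lip p q : Wf p -> Wb p -> Wf q -> Wb q ->
  enorm (p - q) <= (1 + 2 * g / (ah - av) + 2 * g / (bv - bh)) * enorm (pi_th (p - q)).
Proof.
move=> fp bp fq bq; have h1 := Wf_lip fp fq; have h2 := Wb_lip bp bq.
have a0 : 0 < ah - av by rewrite subr_gt0.
have b0 : 0 < bv - bh by rewrite subr_gt0.
have ga : 0 < 2 * g / (ah - av) by rewrite divr_gt0// mulr_gt0.
have gb : 0 < 2 * g / (bv - bh) by rewrite divr_gt0// mulr_gt0.
set C := 1 + _ + _.
have C1 : 1 <= C by rewrite /C; lra.
have C0 : 0 <= C by lra.
rewrite enorm_le ?mulr_ge0 ?enorm_ge0// exprMn dot_split -!enorm_sq.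
move: h1 h2; move: (sqr_ge0 (enorm (pi_th (p - q)))) (sqr_ge0 (enorm (pi_x (p - q)))).
move: (sqr_ge0 (enorm (pi_y (p - q)))).
move: (enorm (pi_th _) ^+ 2) (enorm (pi_x _) ^+ 2) (enorm (pi_y _) ^+ 2).
move=> T X Y Y0 T0 X0 h1 h2.
have aX := mulr_ge0 (ltW a0) X0; have bY := mulr_ge0 (ltW b0) Y0.
have hx : X <= 2 * g / (ah - av) * T.
  by rewrite mulrAC ler_pdivlMr//; lra.
have hy : Y <= 2 * g / (bv - bh) * T.
  by rewrite mulrAC ler_pdivlMr//; lra.
apply: (@le_trans _ _ (C * T)); first by rewrite /C; lra.
by rewrite ler_wpM2r// expr2 ler_peMl.
Qed.

End Graphs.

(** * The invariant set over the inner ball *)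

Lemma Dphi_enorm (R : realType) c u s (Rc r : R) (p : 'cV[R]_(c + (u + s))) :
  0 <= Rc -> 0 <= r -> Dphi Rc r p -> enorm p <= Rc + r + r.
Proof.
move=> Rc0 r0 [+ + +]; rewrite /cball/= !subr0 => h1 h2 h3.
rewrite enorm_le; last by lra.
rewrite dot_split -!enorm_sq; move: h1 h2 h3.
move: (enorm_ge0 (pi_th p)) (enorm_ge0 (pi_x p)) (enorm_ge0 (pi_y p)).
move: (enorm (pi_th _)) (enorm (pi_x _)) (enorm (pi_y _)) => A B C; nra.
Qed.

Theorem theorem2p4 (R : realType) (c u s : nat)
  (F : 'cV[R]_(c + (u + s)) -> 'cV[R]_(c + (u + s)))
  (dom : 'cV[R]_(c + (u + s)) -> set R)
  (Phi : R -> 'cV[R]_(c + (u + s)) -> 'cV[R]_(c + (u + s)))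
  (x0 : 'cV[R]_(c + (u + s)))
  (H : 'cV[R]_(c + (u + s)) -> R)
  (U D : set 'cV[R]_(c + (u + s)))
  (phi psi : 'cV[R]_(c + (u + s)) -> 'cV[R]_(c + (u + s)))
  (Rc r rho gamma alpha_h alpha_v beta_h beta_v : R)
  (b : 'cV[R]_c -> block_data R c u s)
  (h v : R)
  (flowF : is_flow F dom Phi)
  (fixed_x0 : F x0 = 0)
  (intH : integral_of_motion dom Phi H)
  (diffeo_phi : diffeo_on U phi psi)
  (compactD : compact D)
  (subDU : D `<=` U)
  (Dx0 : D x0)
  (Rc_gt0 : 0 < Rc)
  (r_gt0 : 0 < r)
  (phiD : phi @` D = @Dphi R c u s Rc r)
  (C1_Fphi : C1_on (phi @` U) (aligned_field phi psi F))
  (gamma_gt0 : 0 < gamma)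
  (alpha_h_gt0 : 0 < alpha_h)
  (alpha_v_gt0 : 0 < alpha_v)
  (beta_h_gt0 : 0 < beta_h)
  (beta_v_gt0 : 0 < beta_v)
  (alpha_vh : alpha_v < alpha_h)
  (beta_hv : beta_h < beta_v)
  (rho_gt0 : 0 < rho)
  (rho_alpha : r * Num.sqrt (alpha_h / gamma) < rho)
  (rho_beta : r * Num.sqrt (beta_v / gamma) < rho)
  (encl : forall th, cball 0 Rc th ->
     enclosure (aligned_field phi psi F) (Nbox Rc r rho th)
       `<=` in_imx (block_imx (b th)))
  (bounds : forall th, cball 0 Rc th -> block_bounds (b th))
  (v_gt0 : 0 < v)
  (H_inner : forall p, prod3 (cball 0 (Rc - v)) (cball 0 r) (cball 0 r) p ->
     H (psi p) < h)
  (H_outer : forall p, prod3 (boundary (cball 0 Rc)) (cball 0 r) (cball 0 r) p ->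
     h < H (psi p))
  (rates : forall th, cball 0 Rc th ->
     [/\ kappa_c_forw (b th) gamma alpha_h beta_h
           < kappa_u_forw (b th) gamma alpha_h beta_h,
         kappa_s_forw (b th) gamma alpha_h beta_h
           < kappa_u_forw (b th) gamma alpha_h beta_h
       & 0 < kappa_u_forw (b th) gamma alpha_h beta_h] /\
     [/\ kappa_s_back (b th) gamma alpha_v beta_v < 0,
         kappa_s_back (b th) gamma alpha_v beta_v
           < kappa_c_back (b th) gamma alpha_v beta_v
       & kappa_s_back (b th) gamma alpha_v beta_v
           < kappa_u_back (b th) gamma alpha_v beta_v])
  (isolation : forall th, cball 0 Rc th ->
     exists Eu Es : R,
       [/\ 0 < Eu, 0 < Es,
           (forall q, (Nbox Rc r rho th
                         `&` prod3 (cball 0 Rc) [set 0] [set 0]) q ->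
              enorm (pi_x (aligned_field phi psi F q)) < r * Eu /\
              enorm (pi_y (aligned_field phi psi F q)) < r * Es),
           Eu + eps_u (b th) < delta_u (b th)
         & Es + eps_s (b th) < delta_s (b th)]) :
  exists chi : 'cV[R]_c -> 'cV[R]_(c + (u + s)),
    [/\ {within cball 0 (Rc - v), continuous chi},
        (forall th, cball 0 (Rc - v) th -> Dphi Rc r (chi th)),
        (forall th, cball 0 (Rc - v) th ->
           pi_th (chi th) = th /\ stays_in dom Phi D (psi (chi th)))
      & (forall x,
           (psi @` prod3 (cball 0 (Rc - v)) (cball 0 r) (cball 0 r)) x ->
           stays_in dom Phi D x ->
           exists2 th, cball 0 (Rc - v) th & x = psi (chi th))].
Proof.
have [oU ophiU psiphi C1phi C1psi] := diffeo_phi.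
set f := aligned_field phi psi F.
have DphiU p : Dphi Rc r p -> (phi @` U) p.
  by rewrite -phiD => -[x Dx <-]; exists x => //; exact: subDU.
have df p : Dphi Rc r p -> differentiable f p by move=> /DphiU /C1_Fphi[].
have r0 := ltW r_gt0; have Rc0 := ltW Rc_gt0.
have cK : compact (@Dphi R c u s Rc r).
  rewrite -phiD; apply: continuous_compact => //.
  apply: continuous_in_subspaceT => x /set_mem /subDU /C1phi[dx _].
  exact: differentiable_continuous.
have convK p q t : Dphi Rc r p -> Dphi Rc r q -> 0 <= t <= 1 ->
    @Dphi R c u s Rc r (q + t *: (p - q)).
  move=> [p1 p2 p3] [q1 q2 q3] t01.
  have -> : q + t *: (p - q) = join3 (pi_th q + t *: (pi_th p - pi_th q))
      (pi_x q + t *: (pi_x p - pi_x q)) (pi_y q + t *: (pi_y p - pi_y q)).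
    rewrite -[LHS]join3_pi.
    by congr join3; apply/colP => i; rewrite !mxE.
  by split; rewrite ?pi_th_join ?pi_x_join ?pi_y_join; apply: enorm_segment.
have [L L0 f_lip] : exists2 L, 0 < L & forall p q, Dphi Rc r p -> Dphi Rc r q ->
    enorm (f p - f q) <= L * enorm (p - q).
  by apply: C1_lipschitz => // p /DphiU; exact: C1_Fphi.
have D0 : @Dphi R c u s Rc r 0.
  have -> : 0 = join3 0 0 0 :> 'cV[R]_(c + (u + s)) by rewrite /join3 !col_mx0.
  by split; rewrite /cball/= subr0 ?pi_th_join ?pi_x_join ?pi_y_join enorm0.
pose M := enorm (f 0) + L * (Rc + r + r) + 1.
have LR : 0 <= L * (Rc + r + r) by rewrite mulr_ge0 ?addr_ge0 ?(ltW L0).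
have M0 : 0 < M by have := enorm_ge0 (f 0); rewrite /M; lra.
have f_bnd p : Dphi Rc r p -> enorm (f p) <= M.
  move=> Dp; have := f_lip p 0 Dp D0; rewrite subr0.
  have := ler_wpM2l (ltW L0) (Dphi_enorm Rc0 r0 Dp).
  have := enormD (f p - f 0) (f 0); rewrite subrK /M; lra.
have [mf mf0 cone_f] := forward_cone Rc_gt0 r_gt0 df encl bounds
  gamma_gt0 alpha_h_gt0 beta_h_gt0 rho_alpha (fun th Hth => (rates th Hth).1).
have [mb mb0 cone_b] := backward_cone Rc_gt0 r_gt0 df encl bounds
  gamma_gt0 alpha_v_gt0 beta_v_gt0 rho_beta (fun th Hth => (rates th Hth).2).
have out := face_out r_gt0 rho_gt0 df encl bounds isolation.
have inn := face_in r_gt0 rho_gt0 df encl bounds isolation.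
(* Backward orbits are forward orbits of the reversed flow. *)
pose F' x := - F x; pose dom' x := [set t | dom x (- t)].
pose Phi' t x := Phi (- t) x.
have flow' : is_flow F' dom' Phi' by exact: is_flow_rev.
have f'E : aligned_field phi psi F' = fun p => - f p.
  by apply/funext => p; rewrite /aligned_field linearN.
have f'_lip p q : Dphi Rc r p -> Dphi Rc r q ->
    enorm (aligned_field phi psi F' p - aligned_field phi psi F' q) <=
      L * enorm (p - q).
  by move=> Dp Dq; rewrite f'E -opprD enormN; exact: f_lip.
have f'_bnd p : Dphi Rc r p -> enorm (aligned_field phi psi F' p) <= M.
  by move=> Dp; rewrite f'E enormN; exact: f_bnd.
have inner (p : 'cV[R]_(c + (u + s))) :
    prod3 (cball 0 (Rc - v)) (cball 0 r) (cball 0 r) p -> Dphi Rc r p.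
  by move=> [p1 p2 p3]; split=> //; move: p1; rewrite /cball/=; lra.
(* Conservation of [H] closes the lateral boundary of the box. *)
have side p t : prod3 (cball 0 (Rc - v)) (cball 0 r) (cball 0 r) p ->
    dom (psi p) t -> D (Phi t (psi p)) -> enorm (pi_th (phi (Phi t (psi p)))) < Rc.
  move=> pin dt Dt.
  have : Dphi Rc r (phi (Phi t (psi p))) by rewrite -phiD; exists (Phi t (psi p)).
  move=> [q1 q2 q3]; move: (q1); rewrite /cball/= subr0 le_eqVlt.
  move=> /predU1P[qR|//]; exfalso.
  have := H_outer (phi (Phi t (psi p))) (And3 (boundary_cball Rc_gt0 qR) q2 q3).
  rewrite psiphi; last exact: subDU.
  by rewrite intH// => /(lt_trans (H_inner p pin)); rewrite ltxx.
pose Wf p := Dphi Rc r p /\ stays_forward dom Phi D psi p.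
pose Wb p := Dphi Rc r p /\ stays_forward dom' Phi' D psi p.
have cone_b' p q : box (backward_frame R c u s) Rc r p ->
    box (backward_frame R c u s) Rc r q ->
    0 <= cone_form (backward_frame R c u s) beta_v gamma alpha_v (p - q) (p - q) ->
    mb * enorm (p - q) ^+ 2 <=
    cone_form (backward_frame R c u s) beta_v gamma alpha_v (p - q)
      (aligned_field phi psi F' p - aligned_field phi psi F' q).
  by rewrite f'E; exact: cone_b.
have Wf_lip p q : Wf p -> Wf q -> alpha_h * enorm (pi_x (p - q)) ^+ 2 <=
    gamma * enorm (pi_th (p - q)) ^+ 2 + beta_h * enorm (pi_y (p - q)) ^+ 2.
  move=> [Dp sp] [Dq sq].
  have := stays_forward_cone flowF diffeo_phi subDU phiD (box_fwdE c u s Rc r)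
    alpha_h_gt0 gamma_gt0 beta_h_gt0 mf0 cone_f Dp Dq sp sq.
  rewrite /cone_form !fwdE -!enorm_sq; lra.
have Wb_lip p q : Wb p -> Wb q -> beta_v * enorm (pi_y (p - q)) ^+ 2 <=
    gamma * enorm (pi_th (p - q)) ^+ 2 + alpha_v * enorm (pi_x (p - q)) ^+ 2.
  move=> [Dp sp] [Dq sq].
  have := stays_forward_cone flow' diffeo_phi subDU phiD (box_bwdE c u s Rc r)
    beta_v_gt0 gamma_gt0 alpha_v_gt0 mb0 cone_b' Dp Dq sp sq.
  rewrite /cone_form !bwdE -!enorm_sq; lra.
have stays_W p : Dphi Rc r p -> stays_in dom Phi D (psi p) <-> Wf p /\ Wb p.
  move=> Dp; split=> [st|[[_ sf] [_ sb]] t].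
    split; first by split=> // t _; exact: st.
    by split=> // t _; exact: (st (- t)).
  have [t0|t0] := leP 0 t; first exact: sf.
  by have := sb (- t); rewrite oppr_ge0 /dom' /Phi' /= opprK; apply; exact: ltW.
have in3 th x y : enorm th <= Rc - v -> enorm x <= r -> enorm y <= r ->
    prod3 (cball 0 (Rc - v)) (cball 0 r) (cball 0 r) (join3 th x y).
  by move=> *; split; rewrite /cball/= subr0 ?pi_th_join ?pi_x_join ?pi_y_join.
have out_f p : box (forward_frame R c u s) Rc r p ->
    enorm (cx (forward_frame R c u s) p) = r ->
    0 < dot (cx (forward_frame R c u s) p) (cx (forward_frame R c u s) (f p)).
  by rewrite box_fwdE !fwdE; exact: out.
have in_f p : box (forward_frame R c u s) Rc r p ->
    enorm (cy (forward_frame R c u s) p) = r ->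
    dot (cy (forward_frame R c u s) p) (cy (forward_frame R c u s) (f p)) < 0.
  by rewrite box_fwdE !fwdE; exact: inn.
have out_b p : box (backward_frame R c u s) Rc r p ->
    enorm (cx (backward_frame R c u s) p) = r ->
    0 < dot (cx (backward_frame R c u s) p)
      (cx (backward_frame R c u s) (aligned_field phi psi F' p)).
  rewrite box_bwdE !bwdE f'E => Dp pr.
  have -> : pi_y (- f p) = - pi_y (f p) by apply/colP => i; rewrite !mxE.
  by rewrite dotNr oppr_gt0; exact: inn.
have in_b p : box (backward_frame R c u s) Rc r p ->
    enorm (cy (backward_frame R c u s) p) = r ->
    dot (cy (backward_frame R c u s) p)
      (cy (backward_frame R c u s) (aligned_field phi psi F' p)) < 0.
  rewrite box_bwdE !bwdE f'E => Dp pr.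
  have -> : pi_x (- f p) = - pi_x (f p) by apply/colP => i; rewrite !mxE.
  by rewrite dotNr oppr_lt0; exact: out.
have exists_chi th : cball 0 (Rc - v) th ->
    exists p, [/\ pi_th p = th, Dphi Rc r p, Wf p & Wb p].
  rewrite /cball/= subr0 => thR; have thR' : enorm th <= Rc by lra.
  have [||x [y [xr yr fx bx]]] := graphs_meet r_gt0 alpha_v_gt0 beta_h_gt0
      alpha_vh beta_hv Wf_lip Wb_lip (th := th).
  - move=> y yr.
    have [x t xr dt Dt|x xr sx] := stays_forward_exists flowF diffeo_phi subDU phiD
      L0 M0 f_lip f_bnd (box_fwdE c u s Rc r) alpha_h_gt0 gamma_gt0 beta_h_gt0 mf0 Rc0
      r_gt0 cone_f out_f in_f thR' yr.
      by rewrite fwdE; apply: side => //; exact: in3.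
    by exists x => //; split=> //; apply: inner; exact: in3.
  - move=> x xr.
    have [y t yr dt Dt|y yr sy] := stays_forward_exists flow' diffeo_phi subDU phiD
      L0 M0 f'_lip f'_bnd (box_bwdE c u s Rc r) beta_v_gt0 gamma_gt0 alpha_v_gt0 mb0 Rc0
      r_gt0 cone_b' out_b in_b thR' xr.
      by rewrite bwdE; apply: side => //; exact: in3.
    by exists y => //; split=> //; apply: inner; exact: in3.
  by exists (join3 th x y); split=> //; [exact: pi_th_join|apply: inner; exact: in3].
have /choice[chi chiP] : forall th, exists p, cball 0 (Rc - v) th ->
    [/\ pi_th p = th, Dphi Rc r p, Wf p & Wb p].
  move=> th; have [hth|hth] := pselect (cball 0 (Rc - v) th); last by exists 0.
  by have [p hp] := exists_chi th hth; exists p.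
have lip := graphs_lip gamma_gt0 alpha_vh beta_hv Wf_lip Wb_lip.
set C := 1 + _ + _ in lip.
have thB (p q : 'cV[R]_(c + (u + s))) : pi_th (p - q) = pi_th p - pi_th q.
  by apply/colP => i; rewrite !mxE.
exists chi; split.
- apply/subspace_continuousP => th hth; have [e1 D1 f1 b1] := chiP th hth.
  move=> B /nbhs_enormP[e e0 eB]; apply/nbhs_enormP.
  have C0 : 0 < `|C| + 1 by rewrite ltr_wpDl.
  exists (e / (`|C| + 1)); first by rewrite divr_gt0.
  move=> th' + hth'; rewrite ltr_pdivlMr// => th'e; apply: eB.
  have [e2 D2 f2 b2] := chiP th' hth'.
  apply: le_lt_trans (lip _ _ f2 b2 f1 b1) _; rewrite thB e1 e2.
  apply: le_lt_trans th'e; rewrite mulrC ler_wpM2l ?enorm_ge0//.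
  by rewrite (le_trans (ler_norm _))// lerDl.
- by move=> th /chiP[].
- move=> th /chiP[e1 D1 f1 b1]; split=> //.
  exact: (stays_W _ D1).2.
- move=> x [p pin <-] st; have [p1 p2 p3] := pin; exists (pi_th p) => //.
  have [fp bp] := (stays_W p (inner p pin)).1 st.
  have [e1 D1 f1 b1] := chiP _ p1.
  congr psi; apply/eqP; rewrite -subr_eq0; apply/eqP/enorm_eq0/eqP.
  rewrite eq_le enorm_ge0 andbT; apply: le_trans (lip _ _ fp bp f1 b1) _.
  by rewrite thB e1 subrr enorm0 mulr0.
Qed.
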